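(* Let $X$ be a complex Hilbert space with open unit ball $B_X$, let $Y$ be a complex Banach space, and let $\mu$ be a normal weight on $B_X$ (with constants $\delta,a,b$). The spaces $\mathcal{B}_\mu^\nabla(B_X,Y)$, $\mathcal{B}_\mu^R(B_X,Y)$ and $\mathcal{B}_\mu^{\rm aff}(B_X,Y)$ coincide. The spaces $\mathcal{B}_{\mu,0}^\nabla(B_X,Y)$, $\mathcal{B}_{\mu,0}^R(B_X,Y)$ and $\mathcal{B}_{\mu,0}^{\rm aff}(B_X,Y)$ coincide. Moreover, for every $f$ in the first of these spaces, $$\|f\|_{\mathcal{B}_\mu^R(B_X,Y)}\le\|f\|_{\mathcal{B}_\mu^\nabla(B_X,Y)}\le2\sqrt2\,R_\mu\,\|f\|_{\mathcal{B}_\mu^{\rm aff}(B_X,Y)},$$ where $R_\mu=1+\max_{t\in[0,\delta]}\mu(t)\int_0^\delta\frac{dt}{\mu(t)}$.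
   Context: A positive continuous function $\mu$ on $[0,1)$ is normal if there are constants $0\le\delta<1$ and $0<a<b<\infty$ such that $\mu(t)/(1-t)^a$ is decreasing on $[\delta,1)$ with limit $0$ as $t\to1$, and $\mu(t)/(1-t)^b$ is increasing on $[\delta,1)$ with limit $\infty$ as $t\to1$. A normal weight on $B_X$ is $\mu(z)=\mu(\|z\|)$ for such a function. $H(B_X,Y)$ is the space of $Y$-valued holomorphic functions on $B_X$. Fix an orthonormal basis $(e_k)_{k\in\Gamma}$ of $X$ and write $\overline z=\sum_k\overline{z_k}e_k$. For a scalar holomorphic $h$ on $B_X$, $\nabla h(z)=(\partial h/\partial z_k(z))_{k\in\Gamma}\in X$ is the element with $h'(z)(x)=\langle x,\overline{\nabla h(z)}\rangle$, and $Rh(z)=\langle\nabla h(z),\overline z\rangle=h'(z)(z)$. For $f\in H(B_X,Y)$: $\|\nabla f(z)\|=\sup_{u\in Y',\|u\|=1}\|\nabla(u\circ f)(z)\|$ and $\|Rf(z)\|=\sup_{u\in Y',\|u\|=1}|R(u\circ f)(z)|$. For $\lozenge\in\{\nabla,R\}$: $\|f\|_{s\mathcal{B}_\mu^\lozenge}=\sup_{z\in B_X}\mu(z)\|\lozenge f(z)\|$; $\mathcal{B}_\mu^\lozenge(B_X,Y)$ is the set of $f\in H(B_X,Y)$ with $\|f\|_{s\mathcal{B}_\mu^\lozenge}<\infty$, normed by $\|f\|_{\mathcal{B}_\mu^\lozenge}=\|f(0)\|+\|f\|_{s\mathcal{B}_\mu^\lozenge}$; $\mathcal{B}_{\mu,0}^\lozenge(B_X,Y)$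 is the set of those $f\in\mathcal{B}_\mu^\lozenge(B_X,Y)$ with $\lim_{\|z\|\to1}\mu(z)\|\lozenge f(z)\|=0$. For $x\in X$, $\|x\|=1$, let $f(\cdot\,x)(\lambda)=f(\lambda x)$, $\lambda\in\mathbb{C}$, $|\lambda|<1$, with derivative $f'(\cdot\,x)(\lambda)$. Put $\|f\|_{s\mathcal{B}_\mu^{\rm aff}}=\sup_{\|x\|=1}\sup_{|\lambda|<1}\mu(\lambda x)\|f'(\cdot\,x)(\lambda)\|$; $\mathcal{B}_\mu^{\rm aff}(B_X,Y)$ is the set of $f\in H(B_X,Y)$ for which this is finite, with norm $\|f\|_{\mathcal{B}_\mu^{\rm aff}}=\|f(0)\|+\|f\|_{s\mathcal{B}_\mu^{\rm aff}}$; $\mathcal{B}_{\mu,0}^{\rm aff}(B_X,Y)$ is the set of $f\in\mathcal{B}_\mu^{\rm aff}(B_X,Y)$ with $\lim_{|\lambda|\to1}\sup_{\|x\|=1}\mu(\lambda x)\|f'(\cdot\,x)(\lambda)\|=0$. *)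

(* Defs.v *)
From HB Require Import structures.
From mathcomp Require Import all_boot all_order all_algebra.
From mathcomp Require Import sesquilinear.
From mathcomp Require Import complex.
From mathcomp Require Import all_classical all_reals all_analysis.
From mathcomp Require Import summability.

Set Implicit Arguments.
Unset Strict Implicit.
Unset Printing Implicit Defensive.
Import Order.TTheory GRing.Theory Num.Theory.
Import numFieldNormedType.Exports.

Local Open Scope classical_set_scope.
Local Open Scope ring_scope.

(* R[i] as a normed space over itself: the structure every numFieldType has. *)
HB.instance Definition _ (R : realType) :=
  NormedModule.copy R[i] (R[i] : numFieldType).

(* Norms over R[i] take values in R[i]; this is the same norm as an element of R. *)
Definition rnorm (R : realType) (V : normedModType R[i]) (x : V) : R :=
  complex.Re `|x|.

Definition unit_ball (R : realType) (V : normedModType R[i]) : set V :=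
  [set z | rnorm z < 1].

Definition unit_sphere (R : realType) (V : normedModType R[i]) : set V :=
  [set x | rnorm x = 1].

(* Supremum in [0, +oo], so that the supremum over an empty family is 0; this
   occurs when X or Y is the zero space. *)
Definition sup_nneg (R : realType) (A : set (\bar R)) : \bar R :=
  ereal_sup (A `|` [set 0%E]).

(* The filter of limits as the norm tends to 1 from inside the unit ball. *)
Definition norm_to1 (R : realType) (V : normedModType R[i]) : set_system V :=
  filter_from [set r : R | r < 1] (fun r => [set z : V | r < rnorm z < 1]).

Section weight.
Variable R : realType.
Implicit Types (mu : R -> R) (delta a b : R).

(* Only the values of mu on [0, 1) matter. *)
Definition normal_weight mu delta a b : Prop :=
  let quot c := fun t => mu t / (1 - t) `^ c in
  [/\ {within `[0, 1[, continuous mu},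
      (forall t : R, 0 <= t < 1 -> 0 < mu t),
      0 <= delta < 1 /\ 0 < a < b,
      {in `[delta, 1[ &, {homo quot a : s t /~ s <= t}} /\
      quot a t @[t --> 1^'-] --> 0 &
      {in `[delta, 1[ &, {homo quot b : s t / s <= t}} /\
      quot b t @[t --> 1^'-] --> +oo].

Definition R_const mu delta : R :=
  1 + sup [set mu t | t in `[0, delta]] *
      \int[lebesgue_measure]_(t in `[0, delta]) (mu t)^-1.

End weight.

Section dual.
Variables (R : realType) (Y : normedModType R[i]).

Definition dual_norm (u : {scalar Y}) : \bar R :=
  ereal_sup [set (rnorm (u y : R[i]))%:E | y in [set y : Y | rnorm y <= 1]].

Definition dual_sphere : set {scalar Y} :=
  [set u : {scalar Y} | continuous (u : Y -> R[i]) /\ dual_norm u = 1%E].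

End dual.

Section hilbert.
Variables (R : realType) (X : completeNormedModType R[i]).
Variable dot : {dot X for @Num.conj R[i]}.
Variables (Gamma : choiceType) (e : Gamma -> X).

Definition induces_norm : Prop := forall x : X, `|x| ^+ 2 = dot x x.

(* A maximal orthonormal family. *)
Definition orthonormal_basis : Prop :=
  (forall j k, dot (e j) (e k) = (j == k)%:R) /\
  (forall x, (forall k, dot x (e k) = 0) -> x = 0).

(* dot is linear in its first argument, so dot z (e k) is the coordinate z_k;
   sum is the unordered sum, the limit over finite subsets of Gamma. *)
Definition bconj (z : X) : X := sum (fun k => (dot z (e k))^* *: e k).

(* 'D_(e k) h z is the complex partial derivative of h in z_k. *)
Definition grad (h : X -> R[i]) (z : X) : X :=
  sum (fun k => 'D_(e k) h z *: e k).

Definition radial (h : X -> R[i]) (z : X) : R[i] :=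
  dot (grad h z) (bconj z).

Variable Y : completeNormedModType R[i].
Implicit Types (f : X -> Y) (mu : R -> R).

(* A function on the unit ball is represented by a total function; only its
   values on the ball matter. *)
Definition holomorphic_ball : set (X -> Y) :=
  [set f | forall z, unit_ball z -> differentiable f z].

Definition grad_norm f (z : X) : \bar R :=
  sup_nneg [set (rnorm (grad (u \o f) z))%:E | u in @dual_sphere R Y].

Definition radial_norm f (z : X) : \bar R :=
  sup_nneg [set (rnorm (radial (u \o f) z))%:E | u in @dual_sphere R Y].

(* D is grad_norm or radial_norm. *)
Section operator.
Variable D : (X -> Y) -> X -> \bar R.

Definition bloch_seminorm mu f : \bar R :=
  sup_nneg [set ((mu (rnorm z))%:E * D f z)%E | z in @unit_ball R X].

Definition bloch_norm mu f : \bar R :=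
  ((rnorm (f 0))%:E + bloch_seminorm mu f)%E.

Definition bloch_space mu : set (X -> Y) :=
  [set f | holomorphic_ball f /\ (bloch_seminorm mu f < +oo)%E].

Definition little_bloch_space mu : set (X -> Y) :=
  [set f | bloch_space mu f /\
    ((mu (rnorm z))%:E * D f z)%E @[z --> @norm_to1 R X] --> 0%E].

End operator.

Definition slice_term mu f (x : X) (l : R[i]) : \bar R :=
  (mu (rnorm (l *: x)) * rnorm (derive1 (fun w : R[i] => f (w *: x)) l))%:E.

Definition aff_seminorm mu f : \bar R :=
  sup_nneg [set sup_nneg [set slice_term mu f x l | l in @unit_ball R R[i]]
           | x in @unit_sphere R X].

Definition aff_norm mu f : \bar R :=
  ((rnorm (f 0))%:E + aff_seminorm mu f)%E.

Definition aff_space mu : set (X -> Y) :=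
  [set f | holomorphic_ball f /\ (aff_seminorm mu f < +oo)%E].

Definition little_aff_space mu : set (X -> Y) :=
  [set f | aff_space mu f /\
    sup_nneg [set slice_term mu f x l | x in @unit_sphere R X]
      @[l --> @norm_to1 R R[i]] --> 0%E].

End hilbert.

(* Main.v *)
(** All estimates are made sphere by sphere. Let g be u o f for a norm one
functional u, and let c bound |g'(z) z| / |z| for |z| close to r. For
orthogonal unit vectors x and v, the odd part in zeta of g'(z) z at z = s r x +
zeta v vanishes at zeta = 0, and the Schwarz lemma on the disc |s r x + zeta
v|^2 <= r^2 + rho^2 bounds it by c R |zeta| / sqrt (R^2 - s^2 r^2) with R^2 =
r^2 + rho^2. Integrating g'(s z) z in s from 0 to 1 at z = r x +- rho v and
letting rho tend to 0 gives |g'(r x) v| <= 2 c. Together with |g'(r x) x| <= c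
this yields |grad g(r x)| <= sqrt 5 c, and sqrt 5 <= 2 sqrt 2 <= 2 sqrt 2 R_mu.
Conversely the Hahn-Banach theorem recovers |f'(z) z| from the radial norm, and
near the origin the Schwarz lemma bounds f'(lambda x) x by its values on a
circle.

Holomorphy only provides a pointwise derivative, so the Schwarz lemma is
obtained from Goursat's subdivision argument, in polar coordinates: circle
means of a holomorphic function do not depend on the radius, hence its real
part has no strict quadratic maximum. *)

Require Import Defs.
From HB Require Import structures.
From mathcomp Require Import all_boot all_order all_algebra.
From mathcomp Require Import sesquilinear.
From mathcomp Require Import complex.
From mathcomp Require Import all_classical all_reals all_analysis.
From mathcomp Require Import summability finmap ring lra.

Set Implicit Arguments.
Unset Strict Implicit.
Unset Printing Implicit Defensive.
Import Order.TTheory GRing.Theory Num.Theory.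
Import numFieldNormedType.Exports.

Local Open Scope classical_set_scope.
Local Open Scope ring_scope.

Local Notation Re := complex.Re.
Local Notation Im := complex.Im.

(** * Goursat's argument for divergence free fields *)

(** On a single sphere the weight takes one value and cancels: continuity of [mu] replaces the
    weighted bounds by one constant [c] on a thin annulus. An annulus is needed because
    [z |-> g'(z) z] has no known regularity. What is holomorphic along a complex line is the
    increment [g ((1 + eps) z) - g z], which reaches radii slightly above that of [z]; [eps] tends
    to 0 at the end. The odd part in zeta serves twice: it vanishes at zeta = 0, as the Schwarz
    lemma demands, and along the two segments s (r x +- rho v) it integrates to g (r x + rho v) - g
    (r x - rho v), which is 2 rho g'(r x) v to first order. The 2 in 2 c is the integral of 1 / sqrt
    (1 - s) over [0, 1], and 5 = 1^2 + 2^2 comes from splitting a vector into its parts along x and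
    orthogonal to x. At the origin the radial derivative is always 0 and says nothing about f'(0);
    the missing values are pulled inwards from the sphere of radius 1/2. *)

Section goursat.
Variable R : realType.
Implicit Types (a b c d s t x y w h e : R).

Definition itv_int a b (f : R -> R) : R := \int[lebesgue_measure]_(t in `[a, b]) f t.
Local Notation I := itv_int.

(** Every left end lies below every right end, so the supremum of the left ends is a common
    point. *)
Lemma halving_intervals_meet (x : nat -> R) w :
  (forall n, x n <= x n.+1) ->
  (forall n, x n.+1 + w / 2 ^+ n.+1 <= x n + w / 2 ^+ n) ->
  0 <= w ->
  exists q, forall n, x n <= q <= x n + w / 2 ^+ n.
Proof.
move=> xS xwS w0.
have x_homo : {homo x : m n / (m <= n)%N >-> m <= n} by apply/nondecreasing_seqP.
have xw_homo : forall m n, (m <= n)%N ->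
    x n + w / 2 ^+ n <= x m + w / 2 ^+ m.
  move=> m n /subnK <-; elim: (n - m)%N => // k IH.
  by rewrite addSn (le_trans (xwS _)).
have wn n : 0 <= w / 2 ^+ n by rewrite divr_ge0// exprn_ge0.
have ub n m : x m <= x n + w / 2 ^+ n.
  have [mn|nm] := leqP m n.
    by rewrite (le_trans (x_homo _ _ mn))// lerDl.
  by rewrite (le_trans _ (xw_homo _ _ (ltnW nm)))// lerDl.
have supx : has_sup (range x).
  split; first by exists (x 0%N), 0%N.
  by exists (x 0%N + w / 2 ^+ 0); move=> _ [m _ <-].
exists (sup (range x)) => n; apply/andP; split.
  by apply: sup_upper_bound => //; exists n.
by apply: sup_le_ub => [|_ [m _ <-] //]; case: supx.
Qed.

Lemma half_pow_small w e : 0 < e -> exists n, w / 2 ^+ n < e.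
Proof.
move=> e0.
have : (w * (2^-1) ^+ n) @[n --> \oo] --> 0.
  by apply: cvg_geometric; rewrite ger0_norm ?invr_ge0// invf_lt1 ?ltr1n.
move=> /cvgr_lt /(_ e e0) [n _ /(_ n (leqnn n))] /=.
by rewrite exprVn; exists n.
Qed.

(** Bisection for an abstract defect that always survives in one of the four quarters. A rectangle
    is given by its lower left corner and its generation, which fixes the side lengths. *)
Lemma halving_rectangles_meet (Bad : nat -> R * R -> Prop) w h (p0 : R * R) :
  0 <= w -> 0 <= h -> Bad 0%N p0 ->
  (forall n p, Bad n p -> exists i j : bool,
     Bad n.+1 (p.1 + i%:R * (w / 2 ^+ n.+1), p.2 + j%:R * (h / 2 ^+ n.+1))) ->
  exists q : R * R, forall n, exists p, [/\ Bad n p,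
     p.1 <= q.1 <= p.1 + w / 2 ^+ n, p.2 <= q.2 <= p.2 + h / 2 ^+ n,
     p0.1 <= p.1 /\ p.1 + w / 2 ^+ n <= p0.1 + w &
     p0.2 <= p.2 /\ p.2 + h / 2 ^+ n <= p0.2 + h].
Proof.
move=> w0 h0 Bad0 BadS.
pose good_step n (p q : R * R) := exists i j : bool,
  q = (p.1 + i%:R * (w / 2 ^+ n.+1), p.2 + j%:R * (h / 2 ^+ n.+1)).
(* The choice function is total, with an arbitrary value where [Bad] fails, so that the sequence can
   be defined before its badness is proved. *)
have /choice[f Hf] : forall np : nat * (R * R), exists q, Bad np.1 np.2 ->
    Bad np.1.+1 q /\ good_step np.1 np.2 q.
  move=> [n p] /=; have [Bp|] := pselect (Bad n p); last by exists p.
  have [i [j Bij]] := BadS _ _ Bp.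
  by eexists => _; split; [exact: Bij|exists i, j].
pose z := fix z n := if n is m.+1 then f (m, z m) else p0.
have Bz n : Bad n (z n) by elim: n => // n IH; have [] := Hf (n, z n) IH.
have step n : good_step n (z n) (z n.+1) by have [] := Hf (n, z n) (Bz n).
have pw k n : 0 <= k -> 0 <= k / 2 ^+ n :> R.
  by move=> k0; rewrite divr_ge0// exprn_ge0.
have half k n : k / 2 ^+ n = k / 2 ^+ n.+1 + k / 2 ^+ n.+1 :> R.
  by rewrite exprS; field; rewrite expf_neq0.
have z1S n : (z n).1 <= (z n.+1).1 /\
    (z n.+1).1 + w / 2 ^+ n.+1 <= (z n).1 + w / 2 ^+ n.
  have [i [j ->]] := step n; rewrite /= [w / 2 ^+ n]half.
  by have := pw w n.+1 w0; case: i => /=; lra.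
have z2S n : (z n).2 <= (z n.+1).2 /\
    (z n.+1).2 + h / 2 ^+ n.+1 <= (z n).2 + h / 2 ^+ n.
  have [i [j ->]] := step n; rewrite /= [h / 2 ^+ n]half.
  by have := pw h n.+1 h0; case: j => /=; lra.
have [q1 Hq1] := halving_intervals_meet (fun n => (z1S n).1) (fun n => (z1S n).2) w0.
have [q2 Hq2] := halving_intervals_meet (fun n => (z2S n).1) (fun n => (z2S n).2) h0.
exists (q1, q2) => n; exists (z n); split => //=.
- elim: n => [|n [IH1 IH2]]; first by rewrite expr0 divr1.
  by have [] := z1S n; lra.
- elim: n => [|n [IH1 IH2]]; first by rewrite expr0 divr1.
  by have [] := z2S n; lra.
Qed.

Lemma within_itv_integrable a b (f : R -> R) :
  {in `[a, b], continuous f} ->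
  (@lebesgue_measure R).-integrable `[a, b] (EFin \o f).
Proof.
move=> cf; apply: continuous_compact_integrable; first exact: segment_compact.
by apply: continuous_in_subspaceT => x /set_mem /= /cf.
Qed.

Lemma Rintegral_split a m b (f : R -> R) : a <= m -> m <= b ->
  {in `[a, b], continuous f} -> I a b f = I a m f + I m b f.
Proof.
move=> am mb cf; have If := within_itv_integrable cf.
rewrite /itv_int; have := @Rintegral_itvB R f (BLeft a) (BRight b) m If.
rewrite !bnd_simp => /(_ am mb).
rewrite Rintegral_itv_obnd_cbnd; first lra.
apply: integrableS If => //; apply: subset_itvr; by rewrite bnd_simp.
Qed.

Lemma Rintegral_const a b k : a <= b -> I a b (fun=> k) = k * (b - a).
Proof.
move=> ab; rewrite /itv_int Rintegral_cst//= lebesgue_measure_itv/= lte_fin.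
by move: ab; rewrite le_eqVlt => /predU1P[->|ab]; rewrite ?ltxx ?ab /= ?subrr.
Qed.

Lemma Rintegral_near_const a b (f : R -> R) k e : a <= b ->
  {in `[a, b], continuous f} -> {in `[a, b], forall t, `|f t - k| <= e} ->
  `|I a b f - k * (b - a)| <= e * (b - a).
Proof.
move=> ab cf fe.
have If := within_itv_integrable cf.
have Ic (c : R) : (@lebesgue_measure R).-integrable `[a, b] (EFin \o (fun=> c)).
  by apply: within_itv_integrable => x _; exact: cvg_cst.
rewrite ler_distl.
rewrite -mulrBl -mulrDl -!Rintegral_const//.
by apply/andP; split; apply: le_Rintegral => // => // x /= xab;
  have := fe x xab; rewrite ler_distl => /andP[].
Qed.


(** Total differentiability at one point, with partial derivatives [al] and [be]. The explicit
    radius is what a subdivision argument consumes. *)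
Definition expands_at (P : R -> R -> R) (s t al be : R) := forall e, 0 < e ->
  exists2 r, 0 < r & forall s' t', `|s' - s| < r -> `|t' - t| < r ->
    `|P s' t' - P s t - (al * (s' - s) + be * (t' - t))|
      <= e * (`|s' - s| + `|t' - t|).

Lemma expands_at_small (P : R -> R -> R) s t al be : expands_at P s t al be ->
  forall e, 0 < e -> exists2 r, 0 < r & forall s' t',
    `|s' - s| < r -> `|t' - t| < r -> `|P s' t' - P s t| < e.
Proof.
move=> Pst e e0; have [r r0 Hr] := Pst 1 ltr01.
pose M := 1 + `|al| + `|be|; have M0 : 0 < M by rewrite /M; have := normr_ge0 al; have := normr_ge0 be; lra.
exists (Num.min r (e / (2 * M))); first by rewrite lt_min r0 divr_gt0// mulr_gt0.
move=> s' t'; rewrite !lt_min => /andP[sr se] /andP[tr te].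
have := Hr _ _ sr tr; rewrite mul1r => H.
have K : `|al * (s' - s) + be * (t' - t)| <= `|al| * `|s' - s| + `|be| * `|t' - t|.
  by rewrite (le_trans (ler_normD _ _))// !normrM.
have := ler_normB (P s' t' - P s t - (al * (s' - s) + be * (t' - t))) (- (al * (s' - s) + be * (t' - t))).
rewrite opprK normrN subrK => L.
apply: le_lt_trans L _.
have {se} : `|s' - s| * M < e / 2.
  by rewrite -ltr_pdivlMr// -mulrA -invfM.
have {te} : `|t' - t| * M < e / 2.
  by rewrite -ltr_pdivlMr// -mulrA -invfM.
have := normr_ge0 (s' - s); have := normr_ge0 (t' - t).
have := normr_ge0 al; have := normr_ge0 be; rewrite /M.
move: H K; set x := `|s' - s|; set y := `|t' - t|; set A := `|al|; set B := `|be|.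
nra.
Qed.

Lemma expands_at_continuous1 (P : R -> R -> R) s t al be :
  expands_at P s t al be -> {for s, continuous (P^~ t)}.
Proof.
move=> Pst; apply/cvgrPdist_lt => e e0.
have [r r0 Hr] := expands_at_small Pst e0.
apply/nbhs_ballP; exists r => //= s'; rewrite /ball/= distrC => ss'.
by rewrite distrC; apply: Hr; rewrite // subrr normr0.
Qed.

Lemma expands_at_continuous2 (P : R -> R -> R) s t al be :
  expands_at P s t al be -> {for t, continuous (P s)}.
Proof.
move=> Pst; apply/cvgrPdist_lt => e e0.
have [r r0 Hr] := expands_at_small Pst e0.
apply/nbhs_ballP; exists r => //= t'; rewrite /ball/= distrC => tt'.
by rewrite distrC; apply: Hr; rewrite // subrr normr0.
Qed.

(** Continuity exactly along the segments on which each component is integrated: [P] at fixed first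
    argument, [Q] at fixed second argument. *)
Definition sep_continuous (P Q : R -> R -> R) a b c d :=
  (forall s, a <= s <= b -> {in `[c, d], continuous (P s)}) /\
  (forall t, c <= t <= d -> {in `[a, b], continuous (Q^~ t)}).

Lemma sep_continuousS (P Q : R -> R -> R) a b c d a' b' c' d' :
  a <= a' -> b' <= b -> c <= c' -> d' <= d ->
  sep_continuous P Q a b c d -> sep_continuous P Q a' b' c' d'.
Proof.
move=> aa bb cc dd [cP cQ].
have sub (x y x' y' z : R) : x <= x' -> y' <= y -> x' <= z <= y' -> x <= z <= y.
  by move=> xx yy /andP[xz zy]; rewrite (le_trans xx xz) (le_trans zy yy).
split=> [s sab t|t tcd s]; rewrite in_itv/= => H.
  by apply: (cP s (sub _ _ _ _ _ aa bb sab)); rewrite in_itv/= (sub _ _ _ _ _ cc dd H).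
by apply: (cQ t (sub _ _ _ _ _ cc dd tcd)); rewrite in_itv/= (sub _ _ _ _ _ aa bb H).
Qed.

(** The outward flux of the field (P, -Q) through the boundary of a rectangle; equivalently, the
    imaginary part of the contour integral of P + i Q. *)
Definition flux (P Q : R -> R -> R) a b c d :=
  (I c d (P b) - I c d (P a)) - (I a b (Q^~ d) - I a b (Q^~ c)).

(** Each inner edge is shared by two quarters, which count it with opposite signs. *)
Lemma flux_quarters (P Q : R -> R -> R) a b c d m n :
  sep_continuous P Q a b c d -> a <= m <= b -> c <= n <= d ->
  flux P Q a b c d = (flux P Q a m c n + flux P Q m b c n) +
                     (flux P Q a m n d + flux P Q m b n d).
Proof.
move=> [cP cQ] /andP[am mb] /andP[cn nd].
have ab := le_trans am mb; have cd := le_trans cn nd.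
have sP s : a <= s <= b -> I c d (P s) = I c n (P s) + I n d (P s).
  by move=> sab; apply: Rintegral_split (cP s sab).
have sQ t : c <= t <= d -> I a b (Q^~ t) = I a m (Q^~ t) + I m b (Q^~ t).
  by move=> tcd; apply: Rintegral_split (cQ t tcd).
rewrite /flux (sP a) ?lexx// (sP b) ?lexx ?ab// (sQ c) ?lexx// (sQ d) ?lexx ?cd//; ring.
Qed.

(** The affine part of the field contributes [al * W * H] through the [P] edges and the same through
    the [Q] edges, because both expansions share [al]. Only the remainders are left. *)
Lemma flux_local_bound (P Q : R -> R -> R) a b c d s t (al be ga e r : R) :
  sep_continuous P Q a b c d -> 0 <= e -> a <= s <= b -> c <= t <= d ->
  b - a < r -> d - c < r ->
  (forall s' t', `|s' - s| < r -> `|t' - t| < r ->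
    `|P s' t' - P s t - (al * (s' - s) + be * (t' - t))| <= e * (`|s' - s| + `|t' - t|)) ->
  (forall s' t', `|s' - s| < r -> `|t' - t| < r ->
    `|Q s' t' - Q s t - (ga * (s' - s) + al * (t' - t))| <= e * (`|s' - s| + `|t' - t|)) ->
  `|flux P Q a b c d| <= 2 * e * ((b - a) + (d - c)) ^+ 2.
Proof.
move=> [cP cQ] e0 sab tcd Wr Hr HP HQ.
have dist_le (x y u v : R) : x <= u <= y -> x <= v <= y -> `|v - u| <= y - x.
  by rewrite ler_norml; clear; lra.
have ab : a <= b by case/andP: sab => /le_trans; apply.
have cd : c <= d by case/andP: tcd => /le_trans; apply.
have aab : a <= a <= b by rewrite lexx.
have bab : a <= b <= b by rewrite lexx ab.
have ccd : c <= c <= d by rewrite lexx.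
have dcd : c <= d <= d by rewrite lexx cd.
have IB (x y : R) (f g : R -> R) : {in `[x, y], continuous f} -> {in `[x, y], continuous g} ->
    I x y f - I x y g = I x y (fun t => f t - g t).
  by move=> cf cg; rewrite /itv_int RintegralB//; exact: within_itv_integrable.
have near s' t' : a <= s' <= b -> c <= t' <= d ->
    [/\ `|s' - s| < r, `|t' - t| < r &
        e * (`|s' - s| + `|t' - t|) <= e * ((b - a) + (d - c))].
  move=> s'ab t'cd; have A1 := dist_le _ _ _ _ sab s'ab; have A2 := dist_le _ _ _ _ tcd t'cd.
  by split; [exact: le_lt_trans A1 Wr|exact: le_lt_trans A2 Hr|rewrite ler_wpM2l// lerD].
rewrite /flux !IB; [|by [exact: cQ|exact: cP]..].
set W := b - a; set H := d - c.
have W0 : 0 <= W by rewrite subr_ge0.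
have H0 : 0 <= H by rewrite subr_ge0.
(* Opposite points have the same second coordinate, so the [be] terms cancel and [al * W] remains;
   the two remainders give the factor 2. *)
have L1 : `|I c d (fun t => P b t - P a t) - (al * W) * H| <= (2 * (e * (W + H))) * H.
  apply: Rintegral_near_const => //; first by move=> u uc; apply: cvgB; apply: cP.
  move=> u; rewrite in_itv/= => uc.
  have [A1 A2 A3] := near b u bab uc; have [B1 _ B3] := near a u aab uc.
  have := le_trans (HP _ _ A1 A2) A3; have := le_trans (HP _ _ B1 A2) B3.
  rewrite -/W -/H !ler_norml /W; set E := e * _; clear; lra.
have L2 : `|I a b (fun s => Q s d - Q s c) - (al * H) * W| <= (2 * (e * (W + H))) * W.
  apply: Rintegral_near_const => //; first by move=> u ua; apply: cvgB; apply: cQ.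
  move=> u; rewrite in_itv/= => ua.
  have [A1 A2 A3] := near u d ua dcd; have [_ B2 B3] := near u c ua ccd.
  have := le_trans (HQ _ _ A1 A2) A3; have := le_trans (HQ _ _ A1 B2) B3.
  rewrite -/W -/H !ler_norml /H; set E := e * _; clear; lra.
move: L1 L2; set X := I _ _ _; set Y := I _ _ _ => L1 L2.
have -> : X - Y = (X - al * W * H) - (Y - al * H * W) by ring.
apply: le_trans (ler_normB _ _) _; apply: le_trans (lerD L1 L2) _.
by rewrite le_eqVlt; apply/orP; left; apply/eqP; ring.
Qed.

(* Goursat's subdivision argument for the vector field (P, -Q): it only needs
   the divergence to vanish pointwise, not to be continuous. *)
Lemma divergence_free_flux (P Q : R -> R -> R) a b c d : a <= b -> c <= d ->
  (forall s t, a <= s <= b -> c <= t <= d -> exists al be ga,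
    expands_at P s t al be /\ expands_at Q s t ga al) ->
  I c d (P b) - I c d (P a) = I a b (Q^~ d) - I a b (Q^~ c).
Proof.
move=> ab cd PQ.
have cPQ : sep_continuous P Q a b c d.
  split=> [s sab t|t tcd s]; rewrite in_itv/= => H.
    by have [al [be [ga [/expands_at_continuous2]]]] := PQ s t sab H.
  by have [al [be [ga [_ /expands_at_continuous1]]]] := PQ s t H tcd.
pose w := b - a; pose h := d - c.
have w0 : 0 <= w by rewrite subr_ge0.
have h0 : 0 <= h by rewrite subr_ge0.
suff small e : 0 < e -> `|flux P Q a b c d| <= e * (w + h) ^+ 2.
  have : flux P Q a b c d = 0.
    apply/eqP; rewrite -normr_le0; apply/ler_addgt0Pr => e e0; rewrite add0r.
    (* The added 1 covers the degenerate rectangle with [w + h = 0]. *)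
    have M0 : 0 < (w + h) ^+ 2 + 1 by rewrite ltr_wpDl// sqr_ge0.
    apply: le_trans (small (e / ((w + h) ^+ 2 + 1)) _) _; first by rewrite divr_gt0.
    by rewrite -mulrA ger_pMr// mulrC ler_pdivrMr// mul1r lerDl.
  by rewrite /flux => /eqP; rewrite subr_eq0 => /eqP.
move=> e0; rewrite leNgt; apply/negP => big.
pose fluxn n (p : R * R) := flux P Q p.1 (p.1 + w / 2 ^+ n) p.2 (p.2 + h / 2 ^+ n).
pose inside n (p : R * R) := (a <= p.1 /\ p.1 + w / 2 ^+ n <= b) /\
                             (c <= p.2 /\ p.2 + h / 2 ^+ n <= d).
(* The thresholds of the four quarters add up to the threshold of their parent, so an excess of flux
   is inherited by some quarter. *)
pose Bad n p := inside n p /\ e * ((w + h) / 2 ^+ n) ^+ 2 < `|fluxn n p|.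
have pw k n : 0 <= k -> 0 <= k / 2 ^+ n :> R.
  by move=> k0; rewrite divr_ge0// exprn_ge0.
have half k n : k / 2 ^+ n = k / 2 ^+ n.+1 + k / 2 ^+ n.+1 :> R.
  by rewrite exprS; field; rewrite expf_neq0.
have Bad0 : Bad 0%N (a, c).
  rewrite /Bad /inside /fluxn expr0 !divr1 /=.
  by rewrite [a + w]addrC [c + h]addrC !subrK !lexx.
have shift_in (x u y : R) (i : bool) : 0 <= u -> x + (u + u) <= y ->
    x <= x + i%:R * u /\ x + i%:R * u + u <= y.
  by case: i => /=; rewrite ?mul1r ?mul0r; clear; lra.
have BadS n p : Bad n p -> exists i j : bool,
    Bad n.+1 (p.1 + i%:R * (w / 2 ^+ n.+1), p.2 + j%:R * (h / 2 ^+ n.+1)).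
  move=> [[[in1 in2] [in3 in4]] bad].
  have W0 := pw w n.+1 w0; have H0 := pw h n.+1 h0.
  move: bad in2 in4; rewrite /fluxn (half w n) (half h n) (half (w + h) n).
  set W := w / _ in W0 *; set H := h / _ in H0 *; set E := (w + h) / _ => bad in2 in4.
  apply: contrapT => nbad.
  have nb (i j : bool) : `|fluxn n.+1 (p.1 + i%:R * W, p.2 + j%:R * H)| <= e * E ^+ 2.
    rewrite leNgt; apply/negP => F; apply: nbad; exists i, j; split=> //.
    have [G1 G2] := shift_in _ _ _ i W0 in2; have [G3 G4] := shift_in _ _ _ j H0 in4.
    by split; split=> //=; [exact: le_trans in1 G1|exact: le_trans in3 G3].
  have := nb false false; have := nb true false.
  have := nb false true; have := nb true true.
  move: bad; rewrite (@flux_quarters _ _ _ _ _ _ (p.1 + W) (p.2 + H)); last 3 first.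
  - exact: sep_continuousS cPQ.
  - by rewrite lerDl W0 addrA lerDl.
  - by rewrite lerDl H0 addrA lerDl.
  rewrite /fluxn /= !mul0r !mul1r !addr0 -/W -/H -!(addrA p.1) -!(addrA p.2).
  set A := flux _ _ _ _ _ _; set B := flux _ _ _ _ _ _.
  set C := flux _ _ _ _ _ _; set D := flux _ _ _ _ _ _ => bad HD HC HB HA.
  move: bad; apply/negP; rewrite -leNgt.
  apply: le_trans (ler_normD _ _) _.
  apply: le_trans (lerD (ler_normD _ _) (ler_normD _ _)) _.
  apply: le_trans (lerD (lerD HA HB) (lerD HC HD)) _.
  by rewrite le_eqVlt; apply/orP; left; apply/eqP; ring.
have [[q1 q2] Hq] := halving_rectangles_meet w0 h0 Bad0 BadS.
have q1ab : a <= q1 <= b.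
  have [p [_ /andP[A1 A2] _ [A3 A4] _]] := Hq 0%N.
  by rewrite (le_trans A3 A1) (le_trans A2 (le_trans A4 _))//= /w addrC subrK.
have q2cd : c <= q2 <= d.
  have [p [_ _ /andP[A1 A2] _ [A3 A4]]] := Hq 0%N.
  by rewrite (le_trans A3 A1) (le_trans A2 (le_trans A4 _))//= /h addrC subrK.
have [al [be [ga [HP HQ]]]] := PQ _ _ q1ab q2cd.
(* Half of [e] compensates the factor 2 of [flux_local_bound]. *)
have e20 : 0 < e / 2 by rewrite divr_gt0.
have [r1 r10 HP'] := HP _ e20; have [r2 r20 HQ'] := HQ _ e20.
have r0 : 0 < Num.min r1 r2 by rewrite lt_min r10.
have [n Hn] := half_pow_small (w + h) r0.
have [[p1 p2] [[[[/= in1 in2] [/= in3 in4]] bad] /= qp1 qp2 _ _]] := Hq n.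
move: bad; apply/negP; rewrite -leNgt /fluxn /=.
have kE (x u : R) : x + u - x = u by rewrite addrAC subrr add0r.
have wh : w / 2 ^+ n < Num.min r1 r2 /\ h / 2 ^+ n < Num.min r1 r2.
  have := pw w n w0; have := pw h n h0; move: Hn; rewrite mulrDl; clear; lra.
have := @flux_local_bound P Q p1 (p1 + w / 2 ^+ n) p2 (p2 + h / 2 ^+ n) q1 q2 al be ga
  (e / 2) (Num.min r1 r2) (sep_continuousS in1 in2 in3 in4 cPQ) (ltW e20) qp1 qp2.
rewrite !kE -mulrDl (_ : 2 * (e / 2) = e); last by field.
apply; [exact: wh.1|exact: wh.2| |].
- by move=> s' t'; rewrite !lt_min => /andP[? _] /andP[? _]; exact: HP'.
- by move=> s' t'; rewrite !lt_min => /andP[_ ?] /andP[_ ?]; exact: HQ'.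
Qed.

End goursat.

(** * Complex differentiable functions and circle means *)

Section rnorm_theory.
Variable R : realType.
Implicit Type V : normedModType R[i].
Local Open Scope complex_scope.

Lemma rnormE V (x : V) : `|x| = (rnorm x)%:C.
Proof. by rewrite /rnorm RRe_real// ger0_real. Qed.

Lemma rnorm_ge0 V (x : V) : 0 <= rnorm x.
Proof. by rewrite -lecR -rnormE; exact: normr_ge0. Qed.

Lemma rnormD V (x y : V) : rnorm (x + y) <= rnorm x + rnorm y.
Proof. by rewrite -lecR rmorphD /= -!rnormE ler_normD. Qed.

Lemma rnormN V (x : V) : rnorm (- x) = rnorm x.
Proof. by rewrite /rnorm normrN. Qed.

Lemma rnormB V (x y : V) : rnorm (x - y) <= rnorm x + rnorm y.
Proof. by rewrite -(rnormN y) rnormD. Qed.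

Lemma rnorm_distC V (x y : V) : rnorm (x - y) = rnorm (y - x).
Proof. by rewrite -rnormN opprB. Qed.

Lemma rnorm0 V : rnorm (0 : V) = 0.
Proof. by rewrite /rnorm normr0. Qed.

Lemma rnorm0_eq0 V (x : V) : rnorm x = 0 -> x = 0.
Proof. by move=> x0; apply/normr0_eq0; rewrite rnormE x0. Qed.

Lemma rnorm_gt0 V (x : V) : (0 < rnorm x) = (x != 0).
Proof. by rewrite -ltcR -rnormE; exact: normr_gt0. Qed.

Lemma rnormZ V (a : R[i]) (x : V) : rnorm (a *: x) = rnorm a * rnorm x.
Proof. by apply: complexI; rewrite rmorphM /= -!rnormE normrZ. Qed.

Lemma rnormM (a b : R[i]) : rnorm (a * b) = rnorm a * rnorm b.
Proof. exact: rnormZ. Qed.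

Lemma rnormV (a : R[i]) : rnorm a^-1 = (rnorm a)^-1.
Proof. by apply: complexI; rewrite fmorphV /= -!rnormE normfV. Qed.

Lemma rnorm_real (t : R) : rnorm t%:C = `|t|.
Proof. by rewrite /rnorm normc_def /= expr0n addr0 sqrtr_sqr. Qed.

Lemma sqr_rnorm (z : R[i]) : rnorm z ^+ 2 = Re z ^+ 2 + Im z ^+ 2.
Proof. by rewrite /rnorm normc_def /= sqr_sqrtr// addr_ge0 ?sqr_ge0. Qed.

Lemma Re_le_rnorm (z : R[i]) : `|Re z| <= rnorm z.
Proof.
rewrite -(ler_pXn2r (n := 2)) ?nnegrE ?rnorm_ge0//.
by rewrite sqr_rnorm real_normK ?num_real// lerDl sqr_ge0.
Qed.

Lemma Im_le_rnorm (z : R[i]) : `|Im z| <= rnorm z.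
Proof.
rewrite -(ler_pXn2r (n := 2)) ?nnegrE ?rnorm_ge0//.
by rewrite sqr_rnorm [X in X <= _]real_normK ?num_real// lerDr sqr_ge0.
Qed.

Lemma rnorm_le_ReIm (z : R[i]) : rnorm z <= `|Re z| + `|Im z|.
Proof.
rewrite -(ler_pXn2r (n := 2)) ?nnegrE ?rnorm_ge0 ?addr_ge0//.
rewrite sqr_rnorm sqrrD !real_normK ?num_real//.
by rewrite lerD2r lerDl mulrn_wge0// mulr_ge0.
Qed.

(** A unimodular factor reduces bounds on a modulus to bounds on a real part, which is what the
    maximum principle and the real Hahn-Banach theorem handle. *)
Lemma exists_rotation (z : R[i]) : exists2 w : R[i], rnorm w = 1 & w * z = (rnorm z)%:C.
Proof.
have [->|z0] := eqVneq z 0; first by exists 1; rewrite ?rnorm0 ?mulr0// (rnorm_real 1) normr1.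
exists ((rnorm z)%:C / z).
  by rewrite rnormM rnormV rnorm_real ger0_norm ?rnorm_ge0// divff// gt_eqF// rnorm_gt0.
by rewrite divfK.
Qed.

End rnorm_theory.

Section complex_derivative.
Variable R : realType.
Local Open Scope complex_scope.
Implicit Types (f : R[i] -> R[i]) (z w : R[i]) (s t : R).

(** Complex differentiability at one point with derivative [a], with real radii and norms so that it
    translates directly into [expands_at] for the real and imaginary parts. *)
Definition cdiff f z (a : R[i]) := forall e : R, 0 < e ->
  exists2 r, 0 < r & forall w, rnorm (w - z) < r ->
    rnorm (f w - f z - a * (w - z)) <= e * rnorm (w - z).

Definition ccont f z := forall e : R, 0 < e ->
  exists2 r, 0 < r & forall w, rnorm (w - z) < r -> rnorm (f w - f z) < e.

Lemma cdiff_ccont f z a : cdiff f z a -> ccont f z.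
Proof.
move=> fz e e0; have [r r0 Hr] := fz 1 ltr01.
pose M := 1 + rnorm a; have M0 : 0 < M by rewrite ltr_pwDl// rnorm_ge0.
exists (Num.min r (e / M)); first by rewrite lt_min r0 divr_gt0.
move=> w; rewrite lt_min => /andP[wr we].
have -> : f w - f z = (f w - f z - a * (w - z)) + a * (w - z) by rewrite subrK.
apply: le_lt_trans (rnormD _ _) _; rewrite rnormM.
apply: le_lt_trans (lerD (Hr w wr) (lexx _)) _.
by rewrite -mulrDl mulrC -ltr_pdivlMr.
Qed.

Lemma expands_at_mul (p q : R -> R) s t (p' q' : R) :
  (forall e, 0 < e -> exists2 r, 0 < r & forall s', `|s' - s| < r ->
     `|p s' - p s - p' * (s' - s)| <= e * `|s' - s|) ->
  (forall e, 0 < e -> exists2 r, 0 < r & forall t', `|t' - t| < r ->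
     `|q t' - q t - q' * (t' - t)| <= e * `|t' - t|) ->
  expands_at (fun s t => p s * q t) s t (p' * q t) (p s * q').
Proof.
move=> Hp Hq e e0.
pose M := 1 + `|p s| + `|p'| + `|q t| + `|q'|.
have [m1 m2 m3 m4] : [/\ 0 <= `|p s|, 0 <= `|p'|, 0 <= `|q t| & 0 <= `|q'|] by [].
have M0 : 0 < M by rewrite /M; lra.
(* The product leaves three error terms, each allotted a third of [e]; the cap at 1 keeps the second
   factor below [|q t| + 1]. *)
pose e1 := Num.min 1 (e / (3 * M)).
have e10 : 0 < e1 by rewrite lt_min ltr01 divr_gt0// mulr_gt0.
have e11 : e1 <= 1 by rewrite ge_min lexx.
have e1M : e1 * M <= e / 3.
  by rewrite -ler_pdivlMr// -mulrA -invfM ge_min lexx orbT.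
have [r1 r10 Hr1] := Hp e1 e10; have [r2 r20 Hr2] := Hq e1 e10.
have e12 : 0 < e1 / M by rewrite divr_gt0.
exists (Num.min r1 (Num.min r2 (e1 / M))); first by rewrite !lt_min r10 r20.
move=> s' t'; rewrite !lt_min => /and3P[sr1 _ se] /and3P[_ tr2 te].
have := Hr1 _ sr1; have := Hr2 _ tr2; clear Hr1 Hr2 Hp Hq.
set o1 := p s' - _ - _; set o2 := q t' - _ - _ => Ho2 Ho1.
have -> : p s' * q t' - p s * q t - (p' * q t * (s' - s) + p s * q' * (t' - t)) =
  p s * o2 + p' * (s' - s) * (q' * (t' - t) + o2) + o1 * (q t + (q' * (t' - t) + o2)).
  by rewrite /o1 /o2; ring.
have tM : `|t' - t| * M <= e1 by rewrite -ler_pdivlMr// ltW.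
have Hd : `|q' * (t' - t) + o2| <= e1.
  apply: le_trans (ler_normD _ _) _; rewrite normrM.
  move: Ho2 tM; rewrite /M; have := normr_ge0 (t' - t).
  move: (e11) (e10) m1 m2 m3 m4; clear; set y := `|t' - t|; nra.
apply: le_trans (ler_normD _ _) _; apply: le_trans (lerD (ler_normD _ _) (lexx _)) _.
rewrite !normrM.
have Hq2 : `|q t + (q' * (t' - t) + o2)| <= `|q t| + 1.
  by apply: le_trans (ler_normD _ _) _; rewrite lerD2l (le_trans Hd).
set x := `|s' - s|; set y := `|t' - t|.
have x0 : 0 <= x := normr_ge0 _.
  have y0 : 0 <= y := normr_ge0 _.
have T1 : `|p s| * `|o2| <= e / 3 * y.
  apply: le_trans (ler_wpM2l m1 Ho2) _; rewrite mulrA ler_wpM2r//.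
  apply: le_trans e1M; rewrite mulrC ler_wpM2l ?(ltW e10)// /M; lra.
have T2 : `|p'| * x * `|q' * (t' - t) + o2| <= e / 3 * x.
  apply: le_trans (ler_wpM2l _ Hd) _; first by rewrite mulr_ge0.
  rewrite mulrAC ler_wpM2r//.
  apply: le_trans e1M; rewrite mulrC ler_wpM2l ?(ltW e10)// /M; lra.
have T3 : `|o1| * `|q t + (q' * (t' - t) + o2)| <= e / 3 * x.
  apply: le_trans (ler_pM _ _ Ho1 Hq2) _ => //.
  rewrite mulrAC ler_wpM2r//.
  apply: le_trans e1M; rewrite ler_wpM2l ?(ltW e10)// /M; lra.
have ex : 0 <= e * x := mulr_ge0 (ltW e0) x0.
have ey : 0 <= e * y := mulr_ge0 (ltW e0) y0.
move: T1 T2 T3 ex ey; clear.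
set A := `|p s| * _; set B := `|p'| * _ * _; set C := `|o1| * _; lra.
Qed.

Lemma is_derive_expands (p : R -> R) s (p' : R) : is_derive s (1 : R) p p' ->
  forall e, 0 < e -> exists2 r, 0 < r & forall s', `|s' - s| < r ->
     `|p s' - p s - p' * (s' - s)| <= e * `|s' - s|.
Proof.
move=> ps e e0; have dp : derivable p s 1 by [].
have : h^-1 *: (p (h *: 1 + s) - p s) @[h --> 0^'] --> p'.
  by have <- := @derive_val _ _ _ _ _ _ _ ps; exact: dp.
move=> /cvgrPdist_le /(_ e e0) /nbhs_ballP[r /= r0 Hr].
exists r => // s' s's; have [->|ss] := eqVneq s' s.
  by rewrite !subrr mulr0 subr0 normr0 mulr0.
have s0 : s' - s != 0 by rewrite subr_eq0.
have := Hr (s' - s); rewrite /ball/= sub0r normrN => /(_ s's s0).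
rewrite /= /GRing.scale /= mulr1 subrK => H.
have -> : p s' - p s - p' * (s' - s) = - (p' - (s' - s)^-1 * (p s' - p s)) * (s' - s).
  by field.
by rewrite normrM normrN ler_wpM2r.
Qed.

(** This is exp (s + i t). It never vanishes, so circles around a centre are parametrised without
    ever reaching the centre. *)
Definition polar s t : R[i] := (expR s * cos t) +i* (expR s * sin t).

Lemma rnorm_polar s t : rnorm (polar s t) = expR s.
Proof.
apply/eqP; rewrite -(eqrXn2 (n := 2))// ?rnorm_ge0 ?expR_ge0// sqr_rnorm /=.
by rewrite !exprMn -mulrDr cos2Dsin2 mulr1.
Qed.

(** The complex exponential is its own derivative, so the coefficients are its own real and
    imaginary parts. *)
Lemma polar_expands s t (al := expR s * cos t) (be := expR s * sin t) :
  expands_at (fun s t => Re (polar s t)) s t al (- be) /\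
  expands_at (fun s t => Im (polar s t)) s t be al.
Proof.
rewrite /al /be -mulrN; split; apply: expands_at_mul;
  by apply: is_derive_expands; first [exact: is_derive_expR|exact: is_derive_cos|exact: is_derive_sin].
Qed.

(** The chain rule gives the derivative [a * polar s t] in the variable s + i t. The Cauchy-Riemann
    equations show in [Re (a * polar s t)] occurring in both expansions, which is the common [al] of
    [divergence_free_flux]. *)
Lemma expands_at_cdiff_polar f z0 s t a : cdiff f (z0 + polar s t) a ->
  expands_at (fun s t => Re (f (z0 + polar s t))) s t
    (Re (a * polar s t)) (- Im (a * polar s t)) /\
  expands_at (fun s t => Im (f (z0 + polar s t))) s t
    (Im (a * polar s t)) (Re (a * polar s t)).
Proof.
move=> fa; have [E1 E2] := polar_expands s t.
(* One complex estimate whose real and imaginary parts are the two claims. *)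
have main e : 0 < e -> exists2 r, 0 < r & forall s' t', `|s' - s| < r -> `|t' - t| < r ->
    rnorm (f (z0 + polar s' t') - f (z0 + polar s t) -
      a * polar s t * ((s' - s) +i* (t' - t))) <= e * (`|s' - s| + `|t' - t|).
  move=> e0.
  pose N := rnorm (polar s t); pose M := rnorm a + N + 1.
  have N0 : 0 <= N := rnorm_ge0 _; have a0 := rnorm_ge0 a.
  have M0 : 0 < M by rewrite /M; lra.
  pose e1 := Num.min 1 (e / (4 * M)).
  have e10 : 0 < e1 by rewrite lt_min ltr01 divr_gt0// mulr_gt0.
  have e11 : e1 <= 1 by rewrite ge_min lexx.
  have e1M : e1 * M <= e / 4.
    by rewrite -ler_pdivlMr// -mulrA -invfM ge_min lexx orbT.
  have [r1 r10 Hr1] := E1 e1 e10; have [r2 r20 Hr2] := E2 e1 e10.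
  have [rho rho0 Hrho] := fa e1 e10.
  have dM : 0 < rho / (2 * (2 + N)) by rewrite divr_gt0// mulr_gt0//; lra.
  exists (Num.min r1 (Num.min r2 (rho / (2 * (2 + N))))); first by rewrite !lt_min r10 r20.
  move=> s' t'; rewrite !lt_min => /and3P[sr1 sr2 sr] /and3P[tr1 tr2 tr].
  have {Hr1}H1 := Hr1 _ _ sr1 tr1; have {Hr2}H2 := Hr2 _ _ sr2 tr2.
  set x := `|s' - s| in H1 H2 sr *; set y := `|t' - t| in H1 H2 tr *.
  have x0 : 0 <= x := normr_ge0 _.
  have y0 : 0 <= y := normr_ge0 _.
  set d := (s' - s) +i* (t' - t).
  pose o := polar s' t' - polar s t - polar s t * d.
  have Ho : rnorm o <= 2 * e1 * (x + y).
    apply: le_trans (rnorm_le_ReIm _) _.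
    rewrite -mulrA mulr_natl mulr2n; apply: lerD.
      apply: le_trans H1; rewrite le_eqVlt; apply/orP; left; apply/eqP; congr `|_|.
      by rewrite /o /d /polar /=; ring.
    apply: le_trans H2; rewrite le_eqVlt; apply/orP; left; apply/eqP; congr `|_|.
    by rewrite /o /d /polar /=; ring.
  have Hd : rnorm d <= x + y by exact: rnorm_le_ReIm.
  have Hw : rnorm (polar s' t' - polar s t) <= (2 + N) * (x + y).
    have -> : polar s' t' - polar s t = o + polar s t * d by rewrite /o subrK.
    apply: le_trans (rnormD _ _) _; rewrite rnormM mulrDl; apply: lerD; last by rewrite ler_wpM2l.
    apply: le_trans Ho _; rewrite ler_wpM2r ?addr_ge0//; lra.
  have Hwr : rnorm (polar s' t' - polar s t) < rho.
    apply: le_lt_trans Hw _; rewrite mulrC -ltr_pdivlMr; last lra.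
    move: sr tr; rewrite invfM mulrA (mulrAC rho); lra.
  have := Hrho (z0 + polar s' t'); rewrite opprD addrACA subrr add0r => /(_ Hwr) H3.
  have -> : f (z0 + polar s' t') - f (z0 + polar s t) - a * polar s t * d =
    (f (z0 + polar s' t') - f (z0 + polar s t) - a * (polar s' t' - polar s t)) + a * o.
    by rewrite /o; ring.
  apply: le_trans (rnormD _ _) _; rewrite rnormM.
  apply: le_trans (lerD H3 (lexx _)) _.
  apply: le_trans (lerD (ler_wpM2l (ltW e10) Hw) (ler_wpM2l a0 Ho)) _.
  have -> : e1 * ((2 + N) * (x + y)) + rnorm a * (2 * e1 * (x + y)) =
    e1 * (2 + N + 2 * rnorm a) * (x + y) by ring.
  rewrite ler_wpM2r ?addr_ge0//.
  apply: le_trans (_ : e1 * (2 * M) <= _); first by rewrite ler_wpM2l ?(ltW e10)// /M; lra.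
  by move: e1M; rewrite mulrCA; lra.
split=> e e0; have [r r0 Hr] := main e e0; exists r => // s' t' sr tr.
  apply: le_trans (Hr _ _ sr tr); apply: le_trans _ (Re_le_rnorm _).
  rewrite le_eqVlt; apply/orP; left; apply/eqP; congr `|_|.
  by case: (f _) => ? ?; case: (f _) => ? ?; case: (a * _) => ? ? /=; ring.
apply: le_trans (Hr _ _ sr tr); apply: le_trans _ (Im_le_rnorm _).
rewrite le_eqVlt; apply/orP; left; apply/eqP; congr `|_|.
by case: (f _) => ? ?; case: (f _) => ? ?; case: (a * _) => ? ? /=; ring.
Qed.

(* In the coordinates (s, t) |-> exp (s + i t) the Cauchy-Riemann equations say
   that (Re f, - Im f) is divergence free, and the two horizontal sides of
   [s1, s2] x [0, 2 pi] cancel by periodicity. *)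
Lemma circle_integral_const f z0 rho s1 s2 :
  (forall z, 0 < rnorm (z - z0) <= rho -> exists a, cdiff f z a) ->
  s1 <= s2 -> expR s2 <= rho ->
  itv_int 0 (2 * pi) (fun t => Re (f (z0 + polar s2 t))) =
  itv_int 0 (2 * pi) (fun t => Re (f (z0 + polar s1 t))).
Proof.
move=> fd s12 s2rho.
have pi20 : 0 <= 2 * pi :> R by apply: mulr_ge0 => //; exact: pi_ge0.
have H := @divergence_free_flux R (fun s t => Re (f (z0 + polar s t)))
  (fun s t => Im (f (z0 + polar s t))) s1 s2 0 (2 * pi) s12 pi20.
apply/eqP; rewrite -subr_eq0; apply/eqP; rewrite H.
  by apply/eqP; rewrite subr_eq0 /polar mulrC mulr_natr cos2pi sin2pi cos0 sin0.
move=> s t /andP[_ ss2] _.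
have [|a fa] := fd (z0 + polar s t).
  by rewrite addrAC subrr add0r rnorm_polar expR_gt0/= (le_trans _ s2rho)// ler_expR.
have [F1 F2] := expands_at_cdiff_polar fa.
by exists (Re (a * polar s t)), (- Im (a * polar s t)), (Im (a * polar s t)).
Qed.

(* The centre z0 may be a singularity of f: continuity there is enough, which
   is what lets [schwarz] be applied to f z / z. *)
Lemma no_strict_quadratic_max f z0 (rho k : R) : 0 < rho -> 0 < k ->
  ccont f z0 ->
  (forall z, 0 < rnorm (z - z0) <= rho -> exists a, cdiff f z a) ->
  ~ (forall z, rnorm (z - z0) <= rho -> Re (f z) <= Re (f z0) - k * rnorm (z - z0) ^+ 2).
Proof.
move=> rho0 k0 fc fd fmax.
pose e := k * rho ^+ 2 / 2.
have krho : 0 < k * rho ^+ 2 by rewrite mulr_gt0// exprn_gt0.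
have e0 : 0 < e by rewrite divr_gt0.
have [r r0 Hr] := fc e e0.
(* On this small circle the mean of [Re f] is within [e], half of [k * rho ^+ 2], of the central
   value; on the circle of radius [rho] it lies below that value by at least [k * rho ^+ 2]. The two
   means are equal. *)
pose r1 := Num.min rho (r / 2).
have r10 : 0 < r1 by rewrite lt_min rho0 divr_gt0.
have E1 : expR (ln r1) = r1 by rewrite lnK.
have E2 : expR (ln rho) = rho by rewrite lnK.
have r1r : r1 < r by rewrite gt_min; apply/orP; right; rewrite ltr_pdivrMr//; lra.
have r1rho : r1 <= rho by rewrite ge_min lexx.
have s12 : ln r1 <= ln rho by rewrite ler_ln.
have := circle_integral_const fd s12; rewrite E2 => /(_ (lexx _)).
have pi20 : 0 < 2 * pi :> R by rewrite mulr_gt0// pi_gt0.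
have fcont s : expR s <= rho ->
    {in `[0, 2 * pi], continuous (fun t => Re (f (z0 + polar s t)))}.
  move=> srho t _; have [|a fa] := fd (z0 + polar s t).
    by rewrite addrAC subrr add0r rnorm_polar expR_gt0.
  have [F1 _] := expands_at_cdiff_polar fa.
  exact: expands_at_continuous2 F1.
have H1 : `|itv_int 0 (2 * pi) (fun t => Re (f (z0 + polar (ln r1) t))) - Re (f z0) * (2 * pi - 0)|
   < k * rho ^+ 2 * (2 * pi - 0).
  apply: le_lt_trans (_ : e * (2 * pi - 0) < _); last by rewrite /e; nra.
  apply: Rintegral_near_const; [exact: ltW| by apply: fcont; rewrite E1|].
  move=> t _; have := Hr (z0 + polar (ln r1) t); rewrite addrAC subrr add0r rnorm_polar E1.
  move=> /(_ r1r) /ltW; apply: le_trans; apply: le_trans _ (Re_le_rnorm _).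
  by case: (f _) => ? ?; case: (f _).
have H2 : itv_int 0 (2 * pi) (fun t => Re (f (z0 + polar (ln rho) t))) <=
    (Re (f z0) - k * rho ^+ 2) * (2 * pi - 0).
  rewrite -Rintegral_const; last exact: ltW.
  apply: le_Rintegral => //.
  - by apply: within_itv_integrable; apply: fcont; rewrite E2.
  - by apply: within_itv_integrable => x _; exact: cvg_cst.
  - move=> t _; have := fmax (z0 + polar (ln rho) t).
    by rewrite addrAC subrr add0r rnorm_polar E2 lexx => /(_ isT).
move=> H; move: H1; rewrite -H ltr_norml; move: H2; clear; set X := itv_int _ _ _; nra.
Qed.

End complex_derivative.

(** * Maximum principle, Schwarz lemma and mean value inequality *)

Section maximum_principle.
Variable R : realType.
Local Open Scope complex_scope.
Implicit Types (f : R[i] -> R[i]) (z w : R[i]).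

Lemma rnorm_C (t : R) : 0 <= t -> rnorm t%:C = t.
Proof. by move=> t0; rewrite rnorm_real ger0_norm. Qed.

(** Compactness yields a maximum of Re f + k |z|^2. Were it interior, the expansion of |z|^2 there
    would differ from a strict quadratic term by the real part of an affine holomorphic function,
    which can be absorbed into [f]. Then [k] tends to 0. At 0 only continuity is assumed, in view of
    quotients [f z / z]. *)
Lemma maximum_principle_Re f (rho S : R) : 0 < rho ->
  (forall z, rnorm z <= rho -> ccont f z) ->
  (forall z, 0 < rnorm z < rho -> exists a, cdiff f z a) ->
  (forall z, rnorm z = rho -> Re (f z) <= S) ->
  forall z, rnorm z <= rho -> Re (f z) <= S.
Proof.
move=> rho0 fc fd fS.
suff main k : 0 < k -> forall z, rnorm z <= rho ->
    Re (f z) + k * rnorm z ^+ 2 <= S + k * rho ^+ 2.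
  move=> z zrho; apply/ler_addgt0Pr => e e0.
  have r20 : 0 < rho ^+ 2 by rewrite exprn_gt0.
  have := main (e / rho ^+ 2) _ z zrho; rewrite divr_gt0// => /(_ isT).
  rewrite divfK ?gt_eqF//; apply: le_trans.
  by rewrite lerDl mulr_ge0 ?sqr_ge0// divr_ge0// ltW.
move=> k0.
pose F (p : R * R) := Re (f (p.1 +i* p.2)) + k * (p.1 ^+ 2 + p.2 ^+ 2).
pose N (p : R * R) : R := p.1 ^+ 2 + p.2 ^+ 2.
have NE (p : R * R) : N p = rnorm (p.1 +i* p.2) ^+ 2 by rewrite sqr_rnorm.
pose K := [set p : R * R | N p <= rho ^+ 2].
have KE (p : R * R) : K p <-> rnorm (p.1 +i* p.2) <= rho.
  by rewrite /K /= NE ler_pXn2r// nnegrE ?rnorm_ge0// ltW.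
have cN : continuous N.
  move=> p; apply: cvgD; apply: continuousM; (apply: cvg_fst || apply: cvg_snd);
    exact: cvg_id.
have cK : compact K.
  have cX : compact (`[- rho, rho] `*` `[- rho, rho] : set (R * R)).
    by apply: compact_setX; exact: segment_compact.
  apply: subclosed_compact cX _.
    by apply: (@closed_comp _ _ N [set x | x <= rho ^+ 2]) => [p _|]; [exact: cN|exact: closed_le].
  move=> [x y] /KE /= H; split=> /=; rewrite in_itv/= -ler_norml.
    exact: le_trans (Re_le_rnorm (x +i* y)) H.
  exact: le_trans (Im_le_rnorm (x +i* y)) H.
have cF : {within K, continuous F}.
  apply: continuous_in_subspaceT => p /set_mem /KE /fc cp.
  apply: cvgD; last by apply: cvgM; [exact: cvg_cst|exact: cN].
  apply/cvgrPdist_lt => e e0; have [r r0 Hr] := cp e e0.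
  apply/(@nbhs_ballP R (R * R)%type); exists (r / 2) => /=; first by rewrite divr_gt0.
  move=> q [/= q1 q2]; rewrite /ball/= in q1 q2.
  rewrite distrC.
  have := Hr (q.1 +i* q.2) => H.
  apply: le_lt_trans (H _).
    apply: le_trans _ (Re_le_rnorm _).
    by case: (f _) => ? ?; case: (f _).
  apply: le_lt_trans (rnorm_le_ReIm _) _ => /=.
  rewrite (distrC q.1) (distrC q.2); lra.
have K0 : K !=set0 by exists (0, 0); rewrite /K /N /= !expr0n /= addr0 sqr_ge0.
have [[x0 y0] /set_mem /KE /= p0K pmax] := compact_EVT_max K0 cK cF.
set z0 := x0 +i* y0 in p0K.
have zmax z : rnorm z <= rho ->
    Re (f z) + k * rnorm z ^+ 2 <= Re (f z0) + k * rnorm z0 ^+ 2.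
  case: z => x y zrho; have := pmax (x, y); rewrite /F /= !sqr_rnorm /=; apply.
  by apply/mem_set/KE.
move=> z zrho; apply: le_trans (zmax z zrho) _.
have [z0rho|] := leP rho (rnorm z0).
  have <- : rnorm z0 = rho by apply/le_anti; rewrite p0K.
  by rewrite lerD2r fS//; apply/le_anti; rewrite p0K.
move=> z0rho; exfalso.
(* Subtracting the affine part of [k |z|^2] at [z0] leaves a strict maximum. *)
pose cz := z0^*.
pose h z := f z + (2 * k)%:C * cz * (z - z0).
have Reh z1 : Re (h z1) = Re (f z1) + k * (rnorm z1 ^+ 2 - rnorm z0 ^+ 2 - rnorm (z1 - z0) ^+ 2).
  rewrite /h /cz !sqr_rnorm /z0; case: z1 => x y; case: (f _) => ? ? /=; ring.
have hlin z1 a : cdiff f z1 a -> cdiff h z1 (a + (2 * k)%:C * cz).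
  move=> fa e e0; have [r r0 Hr] := fa e e0; exists r => // w /Hr.
  rewrite /h; congr (rnorm _ <= _); ring.
have hc z1 : ccont f z1 -> ccont h z1.
  move=> fc1.
  have lin : cdiff (fun z => (2 * k)%:C * cz * (z - z0)) z1 ((2 * k)%:C * cz).
    move=> e e0; exists 1 => // w _.
    rewrite (_ : _ - _ - _ = 0) ?rnorm0 ?mulr_ge0 ?rnorm_ge0 ?ltW//; ring.
  move=> e e0; have e20 : 0 < e / 2 by rewrite divr_gt0.
  have [r1 r10 H1] := fc1 _ e20; have [r2 r20 H2] := cdiff_ccont lin e20.
  exists (Num.min r1 r2); first by rewrite lt_min r10.
  move=> w; rewrite lt_min => /andP[/H1 {}H1 /H2 {}H2].
  rewrite /h opprD addrACA; apply: le_lt_trans (rnormD _ _) _; lra.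
(* The disc around [z0] must stay in the large disc and avoid 0, where [f] may fail to be
   differentiable, unless 0 is its centre. *)
pose d := if z0 == 0 then rho else Num.min (rnorm z0) (rho - rnorm z0) / 2.
have d0 : 0 < d.
  rewrite /d; case: eqVneq => // z00.
  by rewrite divr_gt0// lt_min rnorm_gt0 z00 subr_gt0.
have inD z1 : rnorm (z1 - z0) <= d -> rnorm z1 <= rho.
  have : rnorm z1 <= rnorm (z1 - z0) + rnorm z0 by rewrite -{1}(subrK z0 z1) rnormD.
  rewrite /d; case: eqVneq => [->|z00]; first by rewrite subr0.
  by have : Num.min (rnorm z0) (rho - rnorm z0) <= rho - rnorm z0;
    [rewrite ge_min lexx orbT|have := rnorm_ge0 z0; lra].
(* For [z0 = 0] the radius [d] is [rho] itself, while differentiability is known only strictly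
   inside; hence another halving. *)
pose d' := d / 2.
have d'0 : 0 < d' by rewrite divr_gt0.
apply: (@no_strict_quadratic_max R h z0 d' k d'0 k0).
- by apply: hc; apply: fc.
- move=> z1 /andP[z10 z1d]; have [|a fa] := fd z1; last by eexists; apply: hlin fa.
  have : rnorm z1 <= rnorm (z1 - z0) + rnorm z0 by rewrite -{1}(subrK z0 z1) rnormD.
  have : rnorm z0 <= rnorm (z1 - z0) + rnorm z1.
    by rewrite rnorm_distC -{1}(subrK z1 z0) rnormD.
  move: z10 z1d; rewrite /d' /d; case: eqVneq => [->|z00].
    rewrite subr0; lra.
  have : Num.min (rnorm z0) (rho - rnorm z0) <= rho - rnorm z0 by rewrite ge_min lexx orbT.
  have : Num.min (rnorm z0) (rho - rnorm z0) <= rnorm z0 by rewrite ge_min lexx.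
  have : 0 < rnorm z0 by rewrite rnorm_gt0.
  set m := Num.min _ _; lra.
- move=> z1 z1d; rewrite !Reh.
  have /zmax : rnorm z1 <= rho by apply: inD; rewrite /d' in z1d; lra.
  rewrite (subrr z0) rnorm0 expr0n /=; lra.
Qed.

Lemma cdiff_div_id f z a : z != 0 -> cdiff f z a ->
  cdiff (fun w => f w / w) z ((a - f z / z) / z).
Proof.
move=> z0 fa e e0.
pose b := f z / z; have fzE : f z = b * z by rewrite /b divfK.
pose n := rnorm z; have n0 : 0 < n by rewrite rnorm_gt0.
pose M := rnorm (a - b) + 1; have M0 : 0 < M by rewrite ltr_wpDl ?rnorm_ge0.
have e10 : 0 < e * n / 4 by rewrite divr_gt0// mulr_gt0.
have [r r0 Hr] := fa _ e10.
have e20 : 0 < e * n ^+ 2 / (4 * M) by rewrite divr_gt0// mulr_gt0// exprn_gt0.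
(* The bound [n / 2] keeps [w] away from 0, with 1 / |w| at most 2 / n. The other two radii control
   the remainder of [f] and the term quadratic in [w - z], each by half of the error. *)
exists (Num.min r (Num.min (n / 2) (e * n ^+ 2 / (4 * M)))).
  by rewrite !lt_min r0 e20 divr_gt0.
move=> w; rewrite !lt_min => /and3P[wr wn we].
have nw : n / 2 <= rnorm w.
  have : n <= rnorm (w - z) + rnorm w by rewrite rnorm_distC /n -{1}(subrK w z) rnormD.
  lra.
have w0 : w != 0 by rewrite -rnorm_gt0; lra.
have {Hr}Hr := Hr w wr.
set d := rnorm (w - z) in Hr wn we *.
have d0 : 0 <= d := rnorm_ge0 _.
have -> : f w / w - f z / z - (a - f z / z) / z * (w - z) =
    (f w - f z - a * (w - z)) / w - (a - b) * (w - z) * (w - z) / (w * z).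
  by rewrite fzE; field; rewrite z0.
apply: le_trans (rnormB _ _) _; rewrite !rnormM !rnormV !rnormM -/d -/n.
have iw : (rnorm w)^-1 <= 2 / n.
  by rewrite -[2 / n]invf_div lef_pV2// posrE ?divr_gt0// (lt_le_trans _ nw)// divr_gt0.
have iw0 : 0 <= (rnorm w)^-1 by rewrite invr_ge0 rnorm_ge0.
have T1 : rnorm (f w - f z - a * (w - z)) / rnorm w <= e / 2 * d.
  apply: le_trans (ler_pM (rnorm_ge0 _) iw0 Hr iw) _.
  by rewrite le_eqVlt; apply/orP; left; apply/eqP; field; rewrite gt_eqF.
have T2 : rnorm (a - b) * d * d / (rnorm w * n) <= e / 2 * d.
  have -> : rnorm (a - b) * d * d / (rnorm w * n) =
      d * (rnorm (a - b) * d * ((rnorm w)^-1 / n)) by rewrite invfM; ring.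
  rewrite [X in _ <= X]mulrC ler_wpM2l//.
  have H3 : d * M <= e * n ^+ 2 / 4.
    rewrite -ler_pdivlMr//; apply: le_trans (ltW we) _.
    by rewrite le_eqVlt; apply/orP; left; apply/eqP; field; rewrite gt_eqF.
  have H4 : rnorm (a - b) * d <= e * n ^+ 2 / 4.
    by apply: le_trans H3; rewrite mulrC ler_wpM2l// /M lerDl.
  apply: le_trans (ler_pM _ _ H4 (_ : _ <= 2 / n / n)) _.
  - exact: mulr_ge0 (rnorm_ge0 _) d0.
  - by rewrite mulr_ge0 ?invr_ge0// ?rnorm_ge0// ltW.
  - by rewrite ler_wpM2r// invr_ge0 ltW.
  - by rewrite le_eqVlt; apply/orP; left; apply/eqP; field; rewrite gt_eqF.
lra.
Qed.

(** The quotient [f z / z] is bounded by [S / rho] on the boundary circle; after a rotation that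
    makes its value at the given point real, the maximum principle applies. *)
Lemma schwarz f (rho S : R) : 0 < rho -> f 0 = 0 ->
  (forall z, rnorm z <= rho -> exists a, cdiff f z a) ->
  (forall z, rnorm z = rho -> rnorm (f z) <= S) ->
  forall z, rnorm z <= rho -> rnorm (f z) <= S / rho * rnorm z.
Proof.
move=> rho0 f0 fd fS z zrho.
have [->|z0] := eqVneq z 0; first by rewrite f0 !rnorm0 mulr0.
have [|a fa] := fd 0; first by rewrite rnorm0 ltW.
(* Filling in the derivative at 0 makes the quotient continuous there. *)
pose q z := if z == 0 then a else f z / z.
have [w w1 wE] := exists_rotation (q z).
pose h z := w * q z.
suff : Re (h z) <= S / rho.
  rewrite /h wE /= /q (negbTE z0) rnormM rnormV.
  by rewrite ler_pdivrMr// rnorm_gt0.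
have qd z1 : rnorm z1 <= rho -> z1 != 0 -> exists b, cdiff q z1 b.
  move=> z1rho z10; have [b fb] := fd _ z1rho.
  eexists => e e0; have [r r0 Hr] := cdiff_div_id z10 fb e0.
  exists (Num.min r (rnorm z1)); first by rewrite lt_min r0 rnorm_gt0.
  move=> u; rewrite lt_min => /andP[ur uz].
  have u0 : u != 0.
    by apply: contraTneq uz => ->; rewrite sub0r rnormN ltxx.
  by rewrite /q (negbTE u0) (negbTE z10); exact: Hr.
have qc : ccont q 0.
  move=> e e0; have e20 : 0 < e / 2 by rewrite divr_gt0.
  have [r r0 Hr] := fa _ e20; exists r => // u ur.
  rewrite /q eqxx; case: eqVneq => [_|u0]; first by rewrite subrr rnorm0.
  have := Hr u ur; rewrite f0 !subr0 => H.
  have un : 0 < rnorm u by rewrite rnorm_gt0.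
  have -> : f u / u - a = (f u - a * u) / u by field.
  rewrite rnormM rnormV; apply: le_lt_trans (_ : e / 2 < _); last by lra.
  by rewrite ler_pdivrMr.
have hd z1 b : cdiff q z1 b -> cdiff h z1 (w * b).
  move=> qb e e0; have [r r0 Hr] := qb _ e0; exists r => // u /Hr.
  by rewrite /h -!mulrA -!mulrBr rnormM w1 mul1r.
have hc : ccont h 0.
  move=> e e0; have [r r0 Hr] := qc _ e0; exists r => // u /Hr.
  by rewrite /h -mulrBr rnormM w1 mul1r.
apply: (maximum_principle_Re rho0 _ _ _ zrho).
- move=> z1 z1rho; have [->//|z10] := eqVneq z1 0.
  by have [b /hd/cdiff_ccont] := qd _ z1rho z10.
- move=> z1 /andP[z10 z1rho]; have [||b /hd hb] := qd z1; [exact: ltW|by rewrite -rnorm_gt0|].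
  by eexists; exact: hb.
- move=> z1 z1E; apply: le_trans (ler_norm _) _; apply: le_trans (Re_le_rnorm _) _.
  have z10 : z1 != 0 by rewrite -rnorm_gt0 z1E.
  rewrite /h /q (negbTE z10) !rnormM rnormV w1 mul1r z1E.
  by rewrite ler_wpM2r ?fS// invr_ge0 ltW.
Qed.

(** * Mean value inequalities *)

(** Again by bisection: if the increment over an interval is too large, so is that over one of its
    halves, and the local bound at the limit point excludes this. *)
Lemma local_lipschitz_itv (k : R -> R[i]) (a b L : R) : a <= b ->
  (forall t, a <= t <= b -> exists2 r, 0 < r & forall t', `|t' - t| < r ->
     rnorm (k t' - k t) <= L * `|t' - t|) ->
  rnorm (k b - k a) <= L * (b - a).
Proof.
move=> ab kL; rewrite leNgt; apply/negP => big.
pose w := b - a; have w0 : 0 <= w by rewrite subr_ge0.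
pose Bad n x := L * (w / 2 ^+ n) < rnorm (k (x + w / 2 ^+ n) - k x).
have half n : w / 2 ^+ n = w / 2 ^+ n.+1 + w / 2 ^+ n.+1.
  by rewrite exprS; field; rewrite expf_neq0.
have step n x : exists y, Bad n x -> Bad n.+1 y /\ (y = x \/ y = x + w / 2 ^+ n.+1).
  have [B0|B0] := pselect (Bad n.+1 x); first by exists x; split=> //; left.
  exists (x + w / 2 ^+ n.+1) => B; split; last by right.
  rewrite /Bad ltNge; apply/negP => B1; move: B0 B; rewrite /Bad => /negP; rewrite -leNgt => B0.
  apply/negP; rewrite -leNgt half addrA.
  set u := x + w / 2 ^+ n.+1 in B0 B1 *; set v := u + _ in B1 *.
  have -> : k v - k x = (k v - k u) + (k u - k x) by rewrite addrA subrK.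
  apply: le_trans (rnormD _ _) _; lra.
have /choice[next Hnext] : forall nx : nat * R, exists y, Bad nx.1 nx.2 ->
    Bad nx.1.+1 y /\ (y = nx.2 \/ y = nx.2 + w / 2 ^+ nx.1.+1).
  by move=> [n x]; exact: step.
pose x := fix x n := if n is m.+1 then next (m, x m) else a.
have Bx n : Bad n (x n).
  elim: n => [|n IH]; last by have [] := Hnext (n, x n) IH.
  by rewrite /Bad /= expr0 divr1 /w (addrC a) subrK.
have wn n : 0 <= w / 2 ^+ n by rewrite divr_ge0// exprn_ge0.
have xS n : x n <= x n.+1.
  by have /= [_ [->|->]] := Hnext (n, x n) (Bx n); rewrite ?lerDl.
have xwS n : x n.+1 + w / 2 ^+ n.+1 <= x n + w / 2 ^+ n.
  rewrite [w / 2 ^+ n]half addrA lerD2r.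
  by have /= [_ [->|->]] := Hnext (n, x n) (Bx n); rewrite ?lerDl.
have [q Hq] := halving_intervals_meet xS xwS w0.
have qab : a <= q <= b by have := Hq 0%N; rewrite /= expr0 divr1 /w (addrC a) subrK.
have [r r0 Hr] := kL q qab.
have [n Hn] := half_pow_small w r0.
have /andP[q1 q2] := Hq n; have := Bx n; rewrite /Bad; apply/negP; rewrite -leNgt.
set y := x n in q1 q2 *; set d := w / _ in q2 Hn *.
have d0 : 0 <= d := wn n.
(* As [q] lies between [y] and [y + d], its two distances add up to exactly [d], so the local bounds
   on both sides lose no constant. *)
have N1 : `|y + d - q| = y + d - q by rewrite ger0_norm// subr_ge0.
have N2 : `|y - q| = q - y by rewrite distrC ger0_norm// subr_ge0.
have := Hr (y + d); rewrite N1 => /(_ ltac:(lra)) H1.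
have := Hr y; rewrite N2 => /(_ ltac:(lra)) H2.
have -> : k (y + d) - k y = (k (y + d) - k q) - (k y - k q) by rewrite opprB addrA subrK.
apply: le_trans (rnormB _ _) _.
apply: le_trans (lerD H1 H2) _; lra.
Qed.

Definition real_cont (k : R -> R[i]) (t : R) := forall e, 0 < e ->
  exists2 r, 0 < r & forall t', `|t' - t| < r -> rnorm (k t' - k t) < e.

(** Made for [odd_increment], whose derivative bound is available for interior parameters only; the
    end points are reached by continuity. *)
Lemma local_lipschitz01 (k : R -> R[i]) (L : R) : 0 <= L ->
  (forall t, 0 < t < 1 -> forall e, 0 < e -> exists2 r, 0 < r & forall t',
     `|t' - t| < r -> rnorm (k t' - k t) <= (L + e) * `|t' - t|) ->
  real_cont k 0 -> real_cont k 1 ->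
  rnorm (k 1 - k 0) <= L.
Proof.
move=> L0 kL k0 k1; apply/ler_addgt0Pr => e e0.
have e30 : 0 < e / 3 by rewrite divr_gt0.
have [r0 r00 H0] := k0 _ e30; have [r1 r10 H1] := k1 _ e30.
pose h := Num.min (1 / 3) (Num.min (r0 / 2) (r1 / 2)).
have h0 : 0 < h by rewrite !lt_min !divr_gt0.
have hE : [/\ h <= 1 / 3, h <= r0 / 2 & h <= r1 / 2].
  by rewrite /h !ge_min !lexx !orbT.
have [h1 h2 h3] := hE.
have {}H0 : rnorm (k h - k 0) < e / 3 by apply: H0; rewrite subr0 ger0_norm ?ltW//; lra.
have {}H1 : rnorm (k (1 - h) - k 1) < e / 3.
  by apply: H1; rewrite addrAC subrr add0r normrN ger0_norm ?ltW//; lra.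
have H : rnorm (k (1 - h) - k h) <= (L + e / 3) * (1 - h - h).
  by apply: local_lipschitz_itv; [lra|move=> t th; apply: kL => //; lra].
have -> : k 1 - k 0 = - (k (1 - h) - k 1) + (k (1 - h) - k h) + (k h - k 0).
  by ring.
apply: le_trans (rnormD _ _) _; apply: le_trans (lerD (rnormD _ _) (lexx _)) _.
rewrite rnormN.
have : (L + e / 3) * (1 - h - h) <= (L + e / 3) * 1 by rewrite ler_wpM2l//; lra.
lra.
Qed.

Lemma cdiff_segment f (al be : R[i]) (M : R) : 0 <= M ->
  (forall t : R, 0 <= t <= 1 -> exists2 a, cdiff f (al + t%:C * be) a & rnorm a <= M) ->
  rnorm (f (al + be) - f al) <= M * rnorm be.
Proof.
move=> M0 fM.
have [->|be0] := eqVneq be 0; first by rewrite addr0 subrr rnorm0 mulr0.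
have n0 : 0 < rnorm be by rewrite rnorm_gt0.
pose k t := f (al + t%:C * be).
suff : rnorm (k 1 - k 0) <= M * rnorm be * (1 - 0).
  by rewrite /k mul1r mul0r addr0 subr0 mulr1.
rewrite subr0 mulr1; apply/ler_addgt0Pr => e e0.
have := @local_lipschitz_itv k 0 1 (M * rnorm be + e) ler01.
rewrite subr0 mulr1; apply=> t t01.
have [a fa aM] := fM t t01.
have e10 : 0 < e / rnorm be by rewrite divr_gt0.
have [r r0 Hr] := fa _ e10.
exists (r / rnorm be); first by rewrite divr_gt0.
move=> t'; rewrite ltr_pdivlMr// => t'r.
have E : al + t'%:C * be - (al + t%:C * be) = (t' - t)%:C * be by rewrite rmorphB /=; ring.
have := Hr (al + t'%:C * be); rewrite E rnormM rnorm_real => /(_ t'r) H.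
rewrite /k; set u := f _ - f _ in H *.
rewrite -(subrK (a * ((t' - t)%:C * be)) u).
apply: le_trans (rnormD _ _) _; rewrite !rnormM rnorm_real.
have : rnorm a * (`|t' - t| * rnorm be) <= M * (`|t' - t| * rnorm be).
  by rewrite ler_wpM2r// mulr_ge0 ?rnorm_ge0.
have eE : e / rnorm be * (`|t' - t| * rnorm be) = e * `|t' - t|.
  by field; rewrite gt_eqF.
rewrite eE in H.
lra.
Qed.

End maximum_principle.

(** * From radial to tangential derivatives *)

Lemma ler_of_sqr (R : realDomainType) (a b : R) : 0 <= b -> a ^+ 2 <= b ^+ 2 -> a <= b.
Proof. by move=> b0 ab; rewrite leNgt; apply/negP => ba; nra. Qed.

Section radial_tangential.
Variables (R : realType) (X : normedModType R[i]).
Local Open Scope complex_scope.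
(** [D z v] stands for g'(z) v. The two hypotheses keep only linearity in [v] and the complex
    derivative along every complex line inside the ball. *)
Variables (g : X -> R[i]) (D : X -> X -> R[i]).
Hypothesis Dlin : forall z a x y, D z (a *: x + y) = a * D z x + D z y.
Hypothesis gD : forall p v zeta, rnorm (p + zeta *: v) < 1 ->
  cdiff (fun l => g (p + l *: v)) zeta (D (p + zeta *: v) v).

Lemma dirD z x y : D z (x + y) = D z x + D z y.
Proof. by rewrite -[in LHS](scale1r x) Dlin mul1r. Qed.

Lemma dir0 z : D z 0 = 0.
Proof. by apply: (@addrI _ (D z 0)); rewrite -dirD !addr0. Qed.

Lemma dirZ z a x : D z (a *: x) = a * D z x.
Proof. by rewrite -[in LHS](addr0 (a *: x)) Dlin dir0 addr0. Qed.

Lemma cdiff_line x l : rnorm (l *: x) < 1 ->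
  cdiff (fun l => g (l *: x)) l (D (l *: x) x).
Proof.
move=> lx e e0; have := @gD 0 x l; rewrite add0r => /(_ lx e e0)[r r0 Hr].
by exists r => // w /Hr; rewrite !add0r.
Qed.

Lemma cdiffB (f1 f2 : R[i] -> R[i]) z a1 a2 : cdiff f1 z a1 -> cdiff f2 z a2 ->
  cdiff (fun z => f1 z - f2 z) z (a1 - a2).
Proof.
move=> H1 H2 e e0; have e20 : 0 < e / 2 by rewrite divr_gt0.
have [r1 r10 {}H1] := H1 _ e20; have [r2 r20 {}H2] := H2 _ e20.
exists (Num.min r1 r2); first by rewrite lt_min r10.
move=> w; rewrite lt_min => /andP[/H1 {}H1 /H2 {}H2].
have -> : f1 w - f2 w - (f1 z - f2 z) - (a1 - a2) * (w - z) =
  (f1 w - f1 z - a1 * (w - z)) - (f2 w - f2 z - a2 * (w - z)) by ring.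
apply: le_trans (rnormB _ _) _; lra.
Qed.

(** The derivative of t |-> g (t z) is g'(t z) z, that is g'(t z)(t z) / t, which is at most c |z|
    in modulus. *)
Lemma radial_increment z (c eps : R) : 0 <= c -> 0 < eps ->
  (1 + eps) * rnorm z < 1 ->
  (forall t, 1 <= t <= 1 + eps ->
     rnorm (D (t%:C *: z) (t%:C *: z)) <= c * rnorm (t%:C *: z)) ->
  rnorm (g ((1 + eps)%:C *: z) - g z) <= eps * c * rnorm z.
Proof.
move=> c0 eps0 zlt Dc.
have := @cdiff_segment R (fun l => g (l *: z)) 1 eps%:C (c * rnorm z).
rewrite scale1r rmorphD /= => H; apply: le_trans (H _ _) _.
- by rewrite mulr_ge0 ?rnorm_ge0.
- move=> t t01; pose u := 1 + t * eps.
  have u1 : 1 <= u <= 1 + eps by rewrite /u; nra.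
  have uE : 1 + t%:C * eps%:C = u%:C by rewrite /u rmorphD rmorphM.
  have un : rnorm u%:C = u by rewrite rnorm_C//; lra.
  exists (D (u%:C *: z) z); rewrite ?uE.
    apply: cdiff_line; rewrite rnormZ un; apply: le_lt_trans zlt.
    by rewrite ler_wpM2r ?rnorm_ge0//; lra.
  have := Dc u u1; rewrite dirZ rnormM rnormZ un mulrCA ler_pM2l//; lra.
- rewrite rnorm_C ?(ltW eps0)// mulrC mulrA; exact: lexx.
Qed.

Lemma radial_derivative_limit z : rnorm z < 1 -> forall e : R, 0 < e ->
  exists2 r, 0 < r & forall eps, 0 < eps < r ->
    rnorm (g ((1 + eps)%:C *: z) - g z - eps%:C * D z z) <= e * eps.
Proof.
move=> z1 e e0.
have := @cdiff_line z 1; rewrite scale1r => /(_ z1 e e0)[r r0 Hr].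
exists r => // eps /andP[eps0 epsr].
have E : (1 + eps)%:C - 1 = eps%:C by rewrite rmorphD /= addrAC subrr add0r.
have := Hr (1 + eps)%:C; rewrite E rnorm_C ?(ltW eps0)// => /(_ epsr).
by rewrite scale1r (mulrC eps%:C).
Qed.

Section around_radius.
Variables (r eta c : R).
Hypotheses (r0 : 0 < r) (eta0 : 0 < eta) (reta : r + eta <= 1) (c0 : 0 <= c).
Hypothesis Dc : forall z, r - eta < rnorm z < r + eta -> rnorm (D z z) <= c * rnorm z.

Lemma radial_increment_annulus z (eps : R) : 0 < eps ->
  r - eta < rnorm z -> (1 + eps) * rnorm z < r + eta ->
  rnorm (g ((1 + eps)%:C *: z) - g z) <= eps * c * rnorm z.
Proof.
move: (r0) (eta0) (reta) (c0) => r0' eta0' reta' c0'.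
move=> eps0 zl zr; apply: radial_increment => //; first exact: lt_le_trans zr reta.
move=> t /andP[t1 teps]; apply: Dc; rewrite rnormZ rnorm_C; last lra.
have z0 := rnorm_ge0 z; nra.
Qed.

(** The increment g ((1 + eps) l x) - g (l x) is holomorphic in [l], vanishes at 0 and is at most
    eps c r on the circle |l| = r. The Schwarz lemma bounds it by eps c |l| inside; division by
    [eps] leads back to the derivative. *)
Lemma radial_bound_inside (x : X) (l : R[i]) : rnorm x = 1 -> rnorm l <= r ->
  rnorm (D (l *: x) x) <= c.
Proof.
move: (r0) (eta0) (reta) (c0) => r0' eta0' reta' c0'.
move=> x1 lr.
have reta2 : 0 < eta / (2 * r) by rewrite divr_gt0// mulr_gt0.
have eta1 : eta < 1 by lra.
have key (eps : R) : 0 < eps < eta / (2 * r) -> forall w : R[i], rnorm w <= r ->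
    rnorm (g ((1 + eps)%:C *: (w *: x)) - g (w *: x)) <= eps * c * rnorm w.
  move=> /andP[eps0 epsr] w wr.
  have epsr' : eps * r < eta / 2.
    by rewrite -ltr_pdivlMr// (lt_le_trans epsr)// invfM mulrA.
  have := @schwarz R (fun w => g ((1 + eps)%:C *: (w *: x)) - g (w *: x)) r (eps * c * r) r0.
  rewrite !scale0r !scaler0 subrr mulfK ?gt_eqF// => /(_ erefl); apply => //.
  - move=> z zr.
    have zx : rnorm (z *: x) < 1 by rewrite rnormZ x1 mulr1; lra.
    have zex : rnorm (z *: ((1 + eps)%:C *: x)) < 1.
      rewrite !rnormZ x1 mulr1 rnorm_C; last lra.
      by apply: le_lt_trans (_ : r * (1 + eps) < 1); [rewrite ler_wpM2r//|]; lra.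
    have := cdiffB (cdiff_line zex) (cdiff_line zx).
    set a := _ - _ => H; exists a => e e0; have [s s0 Hs] := H e e0; exists s => // v /Hs.
    by rewrite !scalerA !(mulrC _ (1 + eps)%:C).
  - move=> z zr; have zx : rnorm (z *: x) = r by rewrite rnormZ x1 mulr1.
    apply: le_trans (radial_increment_annulus eps0 _ _) _; rewrite ?zx; lra.
have dl : rnorm (l *: x) < 1 by rewrite rnormZ x1 mulr1; lra.
have [l0|l0] := eqVneq l 0; last first.
  have ln : 0 < rnorm l by rewrite rnorm_gt0.
  rewrite -(ler_pM2l ln) -rnormM -dirZ mulrC.
  apply/ler_addgt0Pr => e e0.
  have [s s0 Hs] := radial_derivative_limit dl e0.
  pose eps := Num.min (s / 2) (eta / (2 * r) / 2).
  have eps0 : 0 < eps by rewrite lt_min; apply/andP; split; exact: divr_gt0.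
  have epss : eps < s by rewrite gt_min; apply/orP; left; lra.
  have epsr : eps < eta / (2 * r) by rewrite gt_min; apply/orP; right; lra.
  have := Hs eps; rewrite eps0 epss => /(_ isT) H1.
  have := key eps; rewrite eps0 epsr => /(_ isT l lr) H2.
  rewrite -(ler_pM2l eps0) -[X in X * rnorm (D _ _)](rnorm_C (ltW eps0)) -rnormM.
  set u := g _ - g _ in H1 H2.
  rewrite -(subKr u (eps%:C * D (l *: x) (l *: x))).
  apply: le_trans (rnormB _ _) _; nra.
(* At the origin [eps] stays fixed and the point tends to 0 instead: expanding [g] at 0 in both
   points [d] and [(1 + eps) * d] isolates [eps * d * D 0 x], and the two errors sum to
   [e * eps * d]. *)
rewrite l0 scale0r; apply/ler_addgt0Pr => e e0.
pose eps := eta / (2 * r) / 2.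
have eps0 : 0 < eps by exact: divr_gt0.
have epsr : eps < eta / (2 * r) by rewrite /eps; lra.
have x01 : rnorm ((0 : R[i]) *: x) < 1 by rewrite scale0r rnorm0.
have e30 : 0 < e * eps / (2 + eps) by apply: divr_gt0; [exact: mulr_gt0|exact: addr_gt0].
have [s s0 Hs] := cdiff_line x01 e30.
pose d := Num.min r (s / (2 * (1 + eps))).
have d0 : 0 < d by rewrite lt_min r0 divr_gt0// mulr_gt0//; lra.
have dr : d <= r by rewrite ge_min lexx.
have ds : (1 + eps) * d < s.
  have : d <= s / (2 * (1 + eps)) by rewrite ge_min lexx orbT.
  rewrite ler_pdivlMr; last by rewrite mulr_gt0//; lra.
  by rewrite mulrC; lra.
have ds' : d < s by nra.
have := key eps; rewrite eps0 epsr => /(_ isT d%:C); rewrite rnorm_C ?(ltW d0)// => /(_ dr) H2.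
have := Hs d%:C; rewrite subr0 scale0r rnorm_C ?(ltW d0)// => /(_ ds') H3.
have := Hs ((1 + eps) * d)%:C; rewrite subr0 scale0r rnorm_C; last by rewrite mulr_ge0 ?ltW//; lra.
move=> /(_ ds) H4.
rewrite scalerA -rmorphM /= in H2.
have E : (eps * d)%:C * D 0 x = (g (((1 + eps) * d)%:C *: x) - g (d%:C *: x))
   - (g (((1 + eps) * d)%:C *: x) - g 0 - D 0 x * ((1 + eps) * d)%:C)
   + (g (d%:C *: x) - g 0 - D 0 x * d%:C).
  set A1 := g (_ *: x); set A2 := g (_ *: x); set A0 := g 0; set d0x := D 0 x.
  have -> : ((1 + eps) * d)%:C = d%:C + (eps * d)%:C.
    by rewrite -rmorphD /=; congr (_%:C); ring.
  ring.
have ed : 0 < eps * d by rewrite mulr_gt0.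
rewrite -(ler_pM2l ed) -[X in X * rnorm (D _ _)](rnorm_C (ltW ed)) -rnormM E.
apply: le_trans (rnormD _ _) _; apply: le_trans (lerD (rnormB _ _) (lexx _)) _.
apply: le_trans (lerD (lerD H2 H4) H3) _.
rewrite le_eqVlt; apply/orP; left; apply/eqP; field; lra.
Qed.

Variables (x v : X).
Hypothesis pyth : forall al be, rnorm (al *: x + be *: v) ^+ 2 = rnorm al ^+ 2 + rnorm be ^+ 2.


(* The map z |-> D z z is not known to be holomorphic, so the Schwarz lemma is
   applied to the odd part in zeta of the radial difference quotients of g at
   s r x + zeta v, on the disc whose boundary lies on the sphere of radius
   sqrt (r^2 + rho^2). *)
Lemma odd_radial_bound (rho s : R) : 0 < rho -> r ^+ 2 + rho ^+ 2 < (r + eta) ^+ 2 ->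
  0 < s < 1 ->
  let a1 := r%:C *: x + rho%:C *: v in
  let a2 := r%:C *: x - rho%:C *: v in
  is_true (rnorm (D (s%:C *: a1) a1 - D (s%:C *: a2) a2) <=
    2 * c * Num.sqrt (r ^+ 2 + rho ^+ 2) * rho / (r * Num.sqrt (1 - s))).
Proof.
move: (r0) (eta0) (reta) (c0) => r0' eta0' reta' c0'.
move=> rho0 Rlt /andP[s0 s1] a1 a2.
set RR := Num.sqrt _.
have RR0 : 0 < RR by rewrite sqrtr_gt0 addr_gt0// exprn_gt0.
have RR2 : RR ^+ 2 = r ^+ 2 + rho ^+ 2 by rewrite sqr_sqrtr// addr_ge0// sqr_ge0.
have reta0 : 0 < r + eta by rewrite addr_gt0.
have RRlt : RR < r + eta by rewrite -(ltr_pXn2r (n := 2)) ?nnegrE ?ltW// RR2.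
have rRR : r < RR.
  by rewrite -(ltr_pXn2r (n := 2)) ?nnegrE ?ltW// RR2 ltrDl exprn_gt0.
set P := (s * r)%:C *: x.
(* The squared radius of the disc of those zeta for which s r x + zeta v has norm at most [RR]. *)
pose rho02 := RR ^+ 2 - (s * r) ^+ 2.
have r2 : 0 < r ^+ 2 by rewrite exprn_gt0.
have ss : s ^+ 2 < s by rewrite expr2 gtr_pMr.
have rho02E : rho02 = (r ^+ 2 * (1 - s ^+ 2)) + rho ^+ 2.
  by rewrite /rho02 RR2; ring.
have rho2 : 0 < rho ^+ 2 by rewrite exprn_gt0.
have rho020 : 0 < rho02 by rewrite rho02E; nra.
pose rho0' := Num.sqrt rho02.
have rho0'0 : 0 < rho0' by rewrite sqrtr_gt0.
have rho0'2 : rho0' ^+ 2 = rho02 by rewrite sqr_sqrtr// ltW.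
have srho : s * rho <= rho0'.
  apply: ler_of_sqr; first exact: ltW.
  rewrite rho0'2 rho02E exprMn; nra.
have rtau : r * Num.sqrt (1 - s) <= rho0'.
  apply: ler_of_sqr; first exact: ltW.
  rewrite rho0'2 rho02E exprMn.
  rewrite sqr_sqrtr; last lra.
  nra.
have tau0 : 0 < Num.sqrt (1 - s) by rewrite sqrtr_gt0 subr_gt0.
have nP (zeta : R[i]) : rnorm (P + zeta *: v) ^+ 2 = (s * r) ^+ 2 + rnorm zeta ^+ 2.
  by rewrite /P pyth rnorm_real real_normK ?num_real.
have nPle (zeta : R[i]) : rnorm zeta <= rho0' -> rnorm (P + zeta *: v) <= RR.
  move=> zr; apply: ler_of_sqr; first exact: ltW.
  have : rnorm zeta ^+ 2 <= rho0' ^+ 2 by rewrite ler_pXn2r// nnegrE ?rnorm_ge0// ltW.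
  rewrite nP.
  rewrite rho0'2 /rho02; lra.
have nPeq (zeta : R[i]) : rnorm zeta = rho0' -> rnorm (P + zeta *: v) = RR.
  move=> zr; apply/eqP; rewrite -(eqrXn2 (n := 2)) ?rnorm_ge0 ?ltW// nP zr rho0'2 /rho02.
  by apply/eqP; ring.
(* Below [eps0] the dilated point of norm (1 + eps) RR stays within the annulus. *)
pose eps0 := (r + eta - RR) / RR.
have eps00 : 0 < eps0 by rewrite divr_gt0// subr_gt0.
pose w := (s * rho)%:C : R[i].
have wn : rnorm w = s * rho by rewrite rnorm_C// mulr_ge0// ltW.
(* The Schwarz lemma evaluated at zeta = s rho, where s r x +- zeta v is s (r x +- rho v). The
   factor 2 counts the two increments of the odd part. *)
have key (eps : R) : 0 < eps < eps0 ->
   rnorm ((g ((1 + eps)%:C *: (P + w *: v)) - g (P + w *: v)) -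
          (g ((1 + eps)%:C *: (P - w *: v)) - g (P - w *: v))) <=
    2 * (eps * c * RR) / rho0' * (s * rho).
  move=> /andP[e0 eeps].
  have eRR : (1 + eps) * RR < r + eta.
    by move: eeps; rewrite /eps0 ltr_pdivlMr//; lra.
  have H := @schwarz R (fun z => (g ((1 + eps)%:C *: (P + z *: v)) - g (P + z *: v)) -
          (g ((1 + eps)%:C *: (P - z *: v)) - g (P - z *: v))) rho0' (2 * (eps * c * RR)) rho0'0.
  rewrite -wn; apply: H.
  - by rewrite scale0r subr0 addr0 subrr.
  - move=> z zr.
    have z1 : rnorm (P + z *: v) <= RR := nPle _ zr.
    have z2 : rnorm (P + z *: (- v)) <= RR.
      by rewrite scalerN -scaleNr; apply: nPle; rewrite rnormN.
    have e1 : 0 <= 1 + eps by lra.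
    have zz u : rnorm (P + z *: u) <= RR ->
       rnorm ((1 + eps)%:C *: P + z *: ((1 + eps)%:C *: u)) < 1.
      move=> zu; rewrite scalerA (mulrC z) -scalerA -scalerDr rnormZ rnorm_C//.
      apply: le_lt_trans (_ : (1 + eps) * RR < 1); first by rewrite ler_wpM2l.
      by rewrite (lt_le_trans eRR).
    have C1 := gD (zz _ z1). have C2 := gD (zz _ z2).
    have C3 : rnorm (P + z *: v) < 1 by apply: le_lt_trans z1 (lt_le_trans RRlt reta).
    have C4 : rnorm (P + z *: (- v)) < 1 by apply: le_lt_trans z2 (lt_le_trans RRlt reta).
    have := cdiffB (cdiffB C1 (gD C3)) (cdiffB C2 (gD C4)).
    set A := _ - _ => HA; exists A => e ep; have [q q0 Hq] := HA e ep.
    exists q => // u /Hq.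
    have E1 (b : R[i]) (V : X) : (1 + eps)%:C *: P + b *: ((1 + eps)%:C *: V) =
      (1 + eps)%:C *: (P + b *: V) by rewrite scalerDr !scalerA (mulrC b).
    by rewrite !E1 !scalerN.
  - move=> z zr.
    have z1 : rnorm (P + z *: v) = RR := nPeq _ zr.
    have z2 : rnorm (P - z *: v) = RR.
      by rewrite -scaleNr; apply: nPeq; rewrite rnormN.
    apply: le_trans (rnormB _ _) _.
    have B1 : rnorm (g ((1 + eps)%:C *: (P + z *: v)) - g (P + z *: v)) <= eps * c * RR.
      by rewrite -z1; apply: radial_increment_annulus; rewrite ?z1//; lra.
    have B2 : rnorm (g ((1 + eps)%:C *: (P - z *: v)) - g (P - z *: v)) <= eps * c * RR.
      by rewrite -z2; apply: radial_increment_annulus; rewrite ?z2//; lra.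
    lra.
  - by rewrite wn.
have aP : s%:C *: a1 = P + w *: v by rewrite /a1 /P scalerDr !scalerA -!rmorphM.
have aM : s%:C *: a2 = P - w *: v by rewrite /a2 /P scalerBr !scalerA -!rmorphM.
have zp1 : rnorm (s%:C *: a1) < 1.
  rewrite aP; apply: le_lt_trans (nPle _ _) (lt_le_trans RRlt reta); by rewrite wn.
have zm1 : rnorm (s%:C *: a2) < 1.
  rewrite aM -scaleNr; apply: le_lt_trans (nPle _ _) (lt_le_trans RRlt reta).
  by rewrite rnormN wn.
suff main : rnorm (D (s%:C *: a1) (s%:C *: a1) - D (s%:C *: a2) (s%:C *: a2))
    <= 2 * c * RR * s * rho / rho0'.
  move: main; rewrite !dirZ -mulrBr rnormM rnorm_C ?(ltW s0)//.
  rewrite (_ : 2 * c * RR * s * rho / rho0' = s * (2 * c * RR * rho / rho0')); last by ring.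
  rewrite ler_pM2l// => /le_trans; apply.
  apply: ler_wpM2l; first by rewrite !mulr_ge0// ltW.
  by rewrite lef_pV2// posrE// mulr_gt0.
apply/ler_addgt0Pr => e e0.
have e20 : 0 < e / 2 by rewrite divr_gt0.
have [q1 q10 H1] := radial_derivative_limit zp1 e20.
have [q2 q20 H2] := radial_derivative_limit zm1 e20.
pose eps := Num.min (eps0 / 2) (Num.min (q1 / 2) (q2 / 2)).
have ep : 0 < eps by rewrite !lt_min; apply/and3P; split; apply: divr_gt0.
have [L1 L2 L3] : [/\ eps <= eps0 / 2, eps <= q1 / 2 & eps <= q2 / 2].
  by rewrite /eps !ge_min !lexx !orbT.
have {}H1 := H1 eps; have {}H2 := H2 eps.
have {}H1 := H1 ltac:(lra); have {}H2 := H2 ltac:(lra).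
have := key eps ltac:(lra); rewrite -aP -aM => K.
rewrite -(ler_pM2l ep) -[X in X * rnorm _ <= _](rnorm_C (ltW ep)) -rnormM mulrBr.
move: H1 H2 K; set A := D _ _; set B := D _ _; set g1 := g _ - g _; set g2 := g _ - g _.
move=> H1 H2 K.
have -> : eps%:C * A - eps%:C * B = (g1 - g2) - (g1 - eps%:C * A) + (g2 - eps%:C * B) by ring.
apply: le_trans (rnormD _ _) _; apply: le_trans (lerD (rnormB _ _) (lexx _)) _.
apply: le_trans (lerD (lerD K H1) H2) _.
rewrite le_eqVlt; apply/orP; left; apply/eqP; field; lra.
Qed.

(* Substituting s = 1 - t^2 along the segment s (r x +- rho v) cancels the
   singularity 1 / sqrt (1 - s) of [odd_radial_bound]. *)
Lemma odd_increment (rho : R) : 0 < rho -> r ^+ 2 + rho ^+ 2 < (r + eta) ^+ 2 ->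
  rnorm (g (r%:C *: x + rho%:C *: v) - g (r%:C *: x - rho%:C *: v)) <=
    4 * c * Num.sqrt (r ^+ 2 + rho ^+ 2) * rho / r.
Proof.
move: (r0) (eta0) (reta) (c0) => r0' eta0' reta' c0'.
move=> rho0 Rlt; have := odd_radial_bound rho0 Rlt.
set RR := Num.sqrt _.
have RR0 : 0 < RR by rewrite sqrtr_gt0 addr_gt0// exprn_gt0.
have RR2 : RR ^+ 2 = r ^+ 2 + rho ^+ 2 by rewrite sqr_sqrtr// addr_ge0// sqr_ge0.
have RR1 : RR < 1.
  apply: lt_le_trans _ reta; rewrite -(ltr_pXn2r (n := 2)) ?nnegrE ?ltW// ?RR2//.
  by rewrite addr_gt0.
pose a1 := r%:C *: x + rho%:C *: v; pose a2 := r%:C *: x - rho%:C *: v => Hs.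
have an sg : `|sg| = rho -> rnorm (r%:C *: x + sg%:C *: v) = RR.
  move=> sg1; apply/eqP; rewrite -(eqrXn2 (n := 2)) ?rnorm_ge0 ?ltW//.
  by rewrite pyth !rnorm_real sg1 RR2 real_normK ?num_real.
have a1n : rnorm a1 = RR by apply: an; rewrite ger0_norm ?ltW.
have a2n : rnorm a2 = RR.
  by rewrite /a2 -scaleNr -rmorphN; apply: an; rewrite normrN ger0_norm ?ltW.
pose psi (l : R[i]) := g (l *: a1) - g (l *: a2).
pose psi' (l : R[i]) := D (l *: a1) (a1) - D (l *: a2) (a2).
have psid (l : R[i]) : rnorm l <= 1 -> cdiff psi l (psi' l).
  move=> l1; have lRR : rnorm l * RR < 1 by have := rnorm_ge0 l; nra.
  by apply: cdiffB; apply: cdiff_line; rewrite rnormZ ?a1n ?a2n.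
pose k (t : R) := psi (1 - t ^+ 2)%:C.
(* The derivative of [k] at [t] has modulus 2 t |psi'(1 - t^2)|, and the bound on psi' has
   denominator r t, since sqrt (1 - s) = t. *)
pose L := 4 * c * RR * rho / r.
have L0 : 0 <= L by rewrite divr_ge0 ?mulr_ge0// ltW.
have kE : k 1 - k 0 = - (g (r%:C *: x + rho%:C *: v) - g (r%:C *: x - rho%:C *: v)).
  by rewrite /k expr1n subrr expr0n /= subr0 /psi !scale1r !scale0r subrr sub0r.
rewrite -/L -rnormN -kE.
have kinc t : 0 <= t <= 1 -> forall e, 0 < e -> exists2 d, 0 < d & forall t', `|t' - t| < d ->
    rnorm (k t' - k t) <= (rnorm (psi' (1 - t ^+ 2)%:C) + e) * (`|t' - t| * (2 * t + `|t' - t|)).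
  move=> t01 e e0.
  have tn : rnorm (1 - t ^+ 2)%:C <= 1 by rewrite rnorm_C; nra.
  have [d d0 Hd] := psid _ tn e e0.
  exists (Num.min 1 (d / 4)); first by rewrite lt_min ltr01 divr_gt0.
  move=> t'; rewrite lt_min => /andP[t'1 t'd].
  have := Hd (1 - t' ^+ 2)%:C.
  have E : (1 - t' ^+ 2)%:C - (1 - t ^+ 2)%:C = (- ((t' - t) * (2 * t + (t' - t))))%:C.
    by rewrite -rmorphB; congr (_%:C); ring.
  have F : `|2 * t + (t' - t)| <= 2 * t + `|t' - t|.
    by apply: le_trans (ler_normD _ _) _; rewrite lerD2r ger0_norm// mulr_ge0//; case/andP: t01.
  have G : `|t' - t| * `|2 * t + (t' - t)| <= `|t' - t| * (2 * t + `|t' - t|) by rewrite ler_wpM2l.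
  rewrite E rnorm_real normrN normrM => H.
  have {}H : rnorm (k t' - k t - psi' (1 - t ^+ 2)%:C * (- ((t' - t) * (2 * t + (t' - t))))%:C)
      <= e * (`|t' - t| * `|2 * t + (t' - t)|).
    apply: H; apply: le_lt_trans G _.
    have := normr_ge0 (t' - t); case/andP: t01; set y := `|t' - t| in t'1 t'd *; nra.
  rewrite -(subrK (psi' (1 - t ^+ 2)%:C * (- ((t' - t) * (2 * t + (t' - t))))%:C) (k t' - k t)).
  apply: le_trans (rnormD _ _) _; rewrite rnormM rnorm_real normrN normrM.
  have H5 := ler_wpM2l (rnorm_ge0 (psi' (1 - t ^+ 2)%:C)) G.
  have H6 := ler_wpM2l (ltW e0) G.
  rewrite [X in _ <= X]mulrDl; lra.
have kcont t : 0 <= t <= 1 -> real_cont k t.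
  move=> t01 e e0; have [d d0 Hd] := kinc t t01 1 ltr01.
  set A := rnorm _ + 1 in Hd; have A0 : 0 < A by rewrite ltr_wpDl ?rnorm_ge0.
  have e30 : 0 < e / (3 * A) by rewrite divr_gt0// mulr_gt0.
  exists (Num.min d (Num.min 1 (e / (3 * A)))); first by rewrite !lt_min d0 ltr01.
  move=> t'; rewrite !lt_min => /and3P[t'd t'1 t'e].
  apply: le_lt_trans (Hd _ t'd) _.
  move: t'e; rewrite ltr_pdivlMr ?mulr_gt0//.
  have := normr_ge0 (t' - t); case/andP: t01; set y := `|t' - t| in t'1 *; move=> ? ? ? ?.
  apply: le_lt_trans (_ : y * (3 * A) < _) => //.
  have : y * (2 * t + y) <= y * 3 by rewrite ler_wpM2l//; lra.
  nra.
apply: local_lipschitz01 => //; last 2 first.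
- by apply: kcont; rewrite lexx ler01.
- by apply: kcont; rewrite lexx ler01.
move=> t /andP[t0 t1] e e0.
have s01 : 0 < 1 - t ^+ 2 < 1 by nra.
have := Hs _ s01; rewrite -/a1 -/a2 /= -/(psi' _).
have -> : 1 - (1 - t ^+ 2) = t ^+ 2 by ring.
rewrite sqrtr_sqr ger0_norm ?(ltW t0)// => B.
pose M := rnorm (psi' (1 - t ^+ 2)%:C).
have M0 : 0 <= M := rnorm_ge0 _.
have B2 : M * (2 * t) <= L.
  have : M * (2 * t) <= 2 * c * RR * rho / (r * t) * (2 * t) by rewrite ler_wpM2r// mulr_ge0// ltW.
  move/le_trans; apply; rewrite /L le_eqVlt; apply/orP; left; apply/eqP; field.
  by rewrite !gt_eqF.
have e40 : 0 < e / 4 by rewrite divr_gt0.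
have [|d d0 Hd] := kinc t _ _ e40; first by rewrite !ltW.
(* The increment of t^2 exceeds its linear part by a second factor |t' - t|; this radius makes that
   excess cost at most [e / 4]. *)
pose m := e / (4 * (M + e)).
have m0 : 0 < m by rewrite divr_gt0// mulr_gt0//; lra.
exists (Num.min d m); first by rewrite lt_min d0.
move=> t'; rewrite lt_min => /andP[t'd t'm].
apply: le_trans (Hd _ t'd) _; rewrite -/M mulrCA [X in _ <= X]mulrC ler_wpM2l//.
move: t'm; rewrite /m ltr_pdivlMr; last by rewrite mulr_gt0//; lra.
have := normr_ge0 (t' - t); set y := `|t' - t| => y0 ym.
have : e / 4 * (2 * t) <= e / 2 by nra.
have : (M + e / 4) * y <= e / 4 by nra.
lra.
Qed.

(** The symmetric difference in [odd_increment] is 2 rho g'(r x) v up to o(rho). Division by 2 rho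
    leaves 2 c sqrt (r^2 + rho^2) / r, which tends to 2 c. *)
Lemma tangential_bound : r < 1 -> rnorm (D (r%:C *: x) v) <= 2 * c.
Proof.
move: (r0) (eta0) (reta) (c0) => r0' eta0' reta' c0'.
move=> r1; apply/ler_addgt0Pr => e e0.
have x1 : rnorm x = 1.
  have := pyth 1 0; rewrite scale1r scale0r addr0 rnorm0 expr0n /= addr0.
  rewrite (_ : rnorm (1 : R[i]) = 1) ?expr1n; last by rewrite -(rmorph1 (real_complex R)) rnorm_C.
  move=> /eqP.
  by rewrite sqrp_eq1 ?rnorm_ge0// => /eqP.
have rx : rnorm (r%:C *: x + 0 *: v) < 1.
  by rewrite scale0r addr0 rnormZ x1 mulr1 rnorm_C// ltW.
have e20 : 0 < e / 2 by rewrite divr_gt0.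
have [d d0 Hd] := gD rx e20; rewrite scale0r addr0 in Hd.
(* With sqrt (r^2 + rho^2) <= r + rho, the excess over 4 c rho is 2 (2 c / r) rho^2; the choice of
   [rho] below makes it at most e rho. *)
pose m := 2 * c / r + 1.
have m0 : 0 < m by rewrite ltr_wpDl// divr_ge0 ?mulr_ge0// ltW.
pose rho := Num.min (d / 2) (Num.min (eta / 2) (e / (2 * m))).
have m20 : 0 < 2 * m by rewrite mulr_gt0.
have rho0 : 0 < rho by rewrite !lt_min; apply/and3P; split; apply: divr_gt0.
have [L1 L2 L3] : [/\ rho <= d / 2, rho <= eta / 2 & rho <= e / (2 * m)].
  by rewrite /rho !ge_min !lexx !orbT.
have RRle : r ^+ 2 + rho ^+ 2 <= (r + rho) ^+ 2 by nra.
have RRlt : r ^+ 2 + rho ^+ 2 < (r + eta) ^+ 2 by nra.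
have := odd_increment rho0 RRlt.
set RR := Num.sqrt _.
have RRr : RR <= r + rho.
  rewrite -[X in _ <= X]ger0_norm; last by lra.
  by rewrite -sqrtr_sqr ler_wsqrtr.
have := Hd rho%:C; rewrite subr0 rnorm_C ?(ltW rho0)// => /(_ ltac:(lra)) H1.
have := Hd (- rho)%:C; rewrite subr0 rnorm_real normrN ger0_norm ?(ltW rho0)// => /(_ ltac:(lra)).
rewrite rmorphN /= scaleNr mulrN opprK => H2 H3.
rewrite -(ler_pM2l rho0) -[X in X * rnorm _ <= _](rnorm_C (ltW rho0)) -rnormM.
rewrite -(ler_pM2l (ltr0Sn _ 1)).
have -> : 2 * rnorm (rho%:C * D (r%:C *: x) v) = rnorm (2%:C * (rho%:C * D (r%:C *: x) v)).
  by rewrite [in RHS]rnormM rnorm_C.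
move: H1 H2 H3; set A := D _ _; set a1 := g _; set a2 := g _; set a3 := g _ => H1 H2 H3.
have -> : 2%:C * (rho%:C * A) = (a1 - a3) - (a1 - a2 - A * rho%:C) + (a3 - a2 + A * rho%:C).
  by rewrite (_ : 2%:C = 1 + 1) ?rmorphD //=; ring.
apply: le_trans (rnormD _ _) _; apply: le_trans (lerD (rnormB _ _) (lexx _)) _.
apply: le_trans (lerD (lerD H3 H1) H2) _.
have : 4 * c * RR * rho / r <= 4 * c * (r + rho) * rho / r.
  rewrite ler_wpM2r ?invr_ge0 ?(ltW r0)// ler_wpM2r ?(ltW rho0)// ler_wpM2l//; nra.
have -> : 4 * c * (r + rho) * rho / r = 4 * c * rho + 2 * (2 * c / r) * rho * rho.
  by field; rewrite gt_eqF.
have : (2 * c / r) * rho <= e / 2.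
  move: L3; rewrite ler_pdivlMr ?mulr_gt0// /m.
  set q := 2 * c / r; have : 0 <= rho by exact: ltW.
  lra.
nra.
Qed.

End around_radius.
End radial_tangential.

(** * Orthonormal expansions and gradients *)

#[local] Existing Instance totally_filter.

Section hilbert_space.
Variables (R : realType) (X : completeNormedModType R[i]).
Variable dot : {dot X for @Num.conj R[i]}.
Hypothesis hdot : induces_norm dot.
Local Open Scope complex_scope.
Local Open Scope fset_scope.
Local Open Scope ring_scope.
Implicit Types (x y z : X) (a b : R[i]).

Lemma dot_rnorm x : dot x x = (rnorm x ^+ 2)%:C.
Proof. by rewrite -hdot rnormE rmorphXn. Qed.

Lemma dotC x y : dot x y = (dot y x)^*%R.
Proof. by rewrite hermC mul1r. Qed.

Lemma dotZr a x y : dot x (a *: y) = a^*%R * dot x y.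
Proof. exact: linearZr_LR. Qed.

Lemma dotZl a x y : dot (a *: x) y = a * dot x y.
Proof. exact: linearZl_LR. Qed.

Lemma rnorm_conj a : rnorm a^*%R = rnorm a.
Proof. by rewrite /rnorm norm_conjC. Qed.

Lemma dot_suml (I : Type) (r : seq I) (F : I -> X) y :
  dot (\sum_(i <- r) F i) y = \sum_(i <- r) dot (F i) y.
Proof.
elim: r => [|i r IH]; first by rewrite !big_nil linear0l.
by rewrite !big_cons linearDl /= IH.
Qed.

Lemma rnorm_pyth x y : dot x y = 0 -> rnorm (x + y) ^+ 2 = rnorm x ^+ 2 + rnorm y ^+ 2.
Proof. by move=> xy; apply: complexI; rewrite rmorphD /= -!dot_rnorm hnormDd. Qed.

Lemma dot_CauchySchwarz x y : rnorm (dot x y) <= rnorm x * rnorm y.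
Proof.
have [->|y0] := eqVneq y 0; first by rewrite linear0r !rnorm0 mulr0.
have ny : 0 < rnorm y by rewrite rnorm_gt0.
pose t := dot x y / dot y y.
have yy0 : dot y y != 0 by rewrite dot_rnorm -rnorm_gt0 rnorm_C ?exprn_gt0 ?exprn_ge0 ?ltW.
have o : dot (x - t *: y) (t *: y) = 0.
  by rewrite dotZr linearBl /= dotZl /t divfK// subrr mulr0.
have := rnorm_pyth o; rewrite subrK => E.
apply: ler_of_sqr; first by rewrite mulr_ge0 ?rnorm_ge0.
rewrite exprMn E mulrDl.
have -> : rnorm (t *: y) ^+ 2 * rnorm y ^+ 2 = rnorm (dot x y) ^+ 2.
  rewrite rnormZ /t rnormM rnormV dot_rnorm rnorm_C ?exprn_ge0 ?rnorm_ge0//.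
  by field; rewrite gt_eqF.
by rewrite lerDr mulr_ge0 ?exprn_ge0 ?rnorm_ge0.
Qed.

Variables (Gamma : choiceType) (e : Gamma -> X).
Hypothesis he : orthonormal_basis dot e.
Implicit Types (c : Gamma -> R[i]) (J : {fset Gamma}).

Definition fsum c J : X := \sum_(k <- J) c k *: e k.

Lemma dot_fsum_basis c J j : dot (fsum c J) (e j) = if j \in J then c j else 0.
Proof.
have [on _] := he.
rewrite /fsum dot_suml; under eq_bigr do rewrite dotZl on.
case: ifPn => jJ.
  rewrite (big_fsetD1 j) //= eqxx mulr1 big1_fset ?addr0//.
  by move=> k; rewrite !inE => /andP[/negbTE -> _] _; rewrite mulr0.
rewrite big1_fset// => k kJ _; case: eqVneq kJ => [->|]; last by rewrite mulr0.
by rewrite (negbTE jJ).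
Qed.

Lemma rnorm_fsum c J : rnorm (fsum c J) ^+ 2 = \sum_(k <- J) rnorm (c k) ^+ 2.
Proof.
apply: complexI; rewrite -dot_rnorm rmorph_sum /=.
have dfs y : dot y (fsum c J) = \sum_(k <- J) (c k)^*%R * dot y (e k).
  rewrite dotC /fsum dot_suml rmorph_sum /=; apply: eq_bigr => k _.
  by rewrite dotZl rmorphM /= -dotC.
rewrite dfs; rewrite !big_seq; apply: eq_bigr => k kJ.
by rewrite dot_fsum_basis kJ mulrC -normCK rnormE rmorphXn.
Qed.

Lemma fsumU c J J' : fsum c (J `|` J') = fsum c J + fsum c (J' `\` J).
Proof.
rewrite /fsum (big_fsetID _ [in J]) /=; congr (_ + _).
  by apply: eq_fbigl => k; rewrite !inE; case: (k \in J); rewrite ?andbF ?andbT ?orbT.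
by apply: eq_fbigl => k; rewrite !inE; case: (k \in J); rewrite ?andbF ?andbT ?orbT.
Qed.

(** Unordered convergence stated separately, because [sum] is a limit operator whose value is
    meaningful only once convergence is known. *)
Definition sums_to c v := forall ep : R, 0 < ep ->
  exists J0, forall J, J0 `<=` J -> rnorm (fsum c J - v) < ep.

Lemma sums_to_sum c v : sums_to c v -> sum (fun k => c k *: e k) = v.
Proof.
move=> cv; apply: (cvg_lim (@norm_hausdorff _ _)).
apply/cvgrPdist_lt => ep ep0; have epE : ep = (Re ep)%:C by rewrite RRe_real// gtr0_real.
have [J0 HJ0] : exists J0, forall J, J0 `<=` J -> rnorm (fsum c J - v) < Re ep.
  by apply: cv; rewrite -ltcR -epE.
exists J0 => // J /= J0J; rewrite rnormE epE ltcR rnorm_distC.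
by have := HJ0 J J0J; rewrite /fsum big_seq_fsetE.
Qed.

(** Riesz-Fischer: a finite set that nearly attains the supremum of the square sums leaves only
    small orthogonal blocks outside it, so the partial sums are Cauchy. *)
Lemma sums_to_ex c (B : R) : (forall J, \sum_(k <- J) rnorm (c k) ^+ 2 <= B) ->
  exists v, sums_to c v.
Proof.
move=> cB.
pose S := [set \sum_(k <- J) rnorm (c k) ^+ 2 | J in [set: {fset Gamma}]].
have supS : has_sup S.
  split; first by exists (\sum_(k <- fset0) rnorm (c k) ^+ 2), fset0.
  by exists B => _ [J _ <-].
have tail (ep : R) : 0 < ep -> exists J0, forall J, J0 `<=` J -> rnorm (fsum c J - fsum c J0) < ep.
  move=> ep0; have ep20 : 0 < ep ^+ 2 by rewrite exprn_gt0.
  have [_ [J0 _ <-] HJ0] := sup_adherent ep20 supS.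
  exists J0 => J J0J.
  have JE : J = J0 `|` (J `\` J0).
    by apply/fsetP => k; rewrite !inE; have := fsubsetP J0J k; case: (k \in J0) => //= ->.
  have E1 : fsum c J = fsum c J0 + fsum c (J `\` J0).
    by rewrite {1}JE fsumU fsetDDl fsetUid.
  have -> : fsum c J - fsum c J0 = fsum c (J `\` J0) by rewrite E1 addrAC subrr add0r.
  rewrite -(ltr_pXn2r (n := 2)) ?nnegrE ?rnorm_ge0 ?(ltW ep0)//.
  have Jsup : rnorm (fsum c J) ^+ 2 <= sup S.
    by rewrite rnorm_fsum; apply: sup_upper_bound => //; exists J.
  have o : dot (fsum c J0) (fsum c (J `\` J0)) = 0.
    rewrite dotC /fsum dot_suml rmorph_sum /= big1_fset// => k kJ _.
    rewrite dotZl dotC dot_fsum_basis; move: kJ; rewrite inE => /andP[/negbTE -> _].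
    by rewrite conjC0 mulr0 conjC0.
  have := rnorm_pyth o; rewrite -E1 => E2.
  by move: HJ0 Jsup; rewrite -rnorm_fsum E2; lra.
have cauchyF : cauchy (fsum c @ totally).
  apply: cauchy_exP => ep ep0.
  have epE : ep = (Re ep)%:C by rewrite RRe_real// gtr0_real.
  have [J0 HJ0] : exists J0, forall J, J0 `<=` J -> rnorm (fsum c J - fsum c J0) < Re ep.
    by apply: tail; rewrite -ltcR -epE.
  exists (fsum c J0); exists J0 => // J /= J0J.
  rewrite -ball_normE /= rnormE epE ltcR rnorm_distC; exact: HJ0.
have /cauchy_cvg/cvg_ex[v Hv] := cauchyF.
exists v => ep ep0; move/cvgrPdist_lt : Hv => /(_ ep%:C).
rewrite -[X in X < _ -> _]/(0%:C) ltcR => /(_ ep0)[J0 _ HJ0].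
exists J0 => J /HJ0 /=; by rewrite rnormE ltcR rnorm_distC.
Qed.

Lemma sums_to_dot c v y : sums_to c v -> forall ep : R, 0 < ep ->
  exists J0, forall J, J0 `<=` J -> rnorm (dot (fsum c J) y - dot v y) < ep.
Proof.
move=> cv ep ep0.
have n0 : 0 < rnorm y + 1 by rewrite ltr_wpDl ?rnorm_ge0.
have [J0 HJ0] := cv (ep / (rnorm y + 1)) (divr_gt0 ep0 n0).
exists J0 => J /HJ0; rewrite ltr_pdivlMr// -linearBl; apply: le_lt_trans.
apply: le_trans (dot_CauchySchwarz _ _) _.
by rewrite ler_wpM2l ?rnorm_ge0// lerDl.
Qed.

Lemma rnorm_small_eq (a b : R[i]) : (forall ep : R, 0 < ep -> rnorm (a - b) < ep) -> a = b.
Proof.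
move=> H; apply/eqP; rewrite -subr_eq0 -normr_le0 rnormE -[X in _ <= X]/(0%:C) lecR.
by apply/ler_addgt0Pr => ep ep0; rewrite add0r ltW// H.
Qed.

Lemma dot_sums_to_basis c v j : sums_to c v -> dot v (e j) = c j.
Proof.
move=> cv; apply: rnorm_small_eq => ep ep0.
have [J0 HJ0] := sums_to_dot (e j) cv ep0.
have := HJ0 (j |` J0) (fsubsetU1 _ _); rewrite dot_fsum_basis !inE eqxx /=.
by rewrite rnorm_distC.
Qed.

Lemma rnorm_sums_to c v (B : R) : 0 <= B ->
  (forall J, \sum_(k <- J) rnorm (c k) ^+ 2 <= B ^+ 2) -> sums_to c v -> rnorm v <= B.
Proof.
move=> B0 cB cv; apply/ler_addgt0Pr => ep ep0.
have [J HJ] := cv ep ep0; have {}HJ := HJ J (fsubset_refl J).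
have JB : rnorm (fsum c J) <= B by apply: ler_of_sqr => //; rewrite rnorm_fsum.
rewrite -(subrK (fsum c J) v); apply: le_trans (rnormD _ _) _.
rewrite rnorm_distC; lra.
Qed.

Lemma bessel x J : \sum_(k <- J) rnorm (dot x (e k)) ^+ 2 <= rnorm x ^+ 2.
Proof.
rewrite -rnorm_fsum; set p := fsum _ J.
have o : dot (x - p) p = 0.
  rewrite dotC {1}/p /fsum dot_suml rmorph_sum /= big1_fset// => k kJ _.
  rewrite dotZl (dotC (e k)) linearBl /= dot_fsum_basis kJ subrr conjC0 mulr0.
  by rewrite conjC0.
by have := rnorm_pyth o; rewrite subrK => ->; rewrite lerDr sqr_ge0.
Qed.

(** Bessel's inequality makes the series converge; its limit has the same coefficients as [x], and
    maximality of the family forces equality. *)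
Lemma basis_expansion x : sums_to (fun k => dot x (e k)) x.
Proof.
have [v cv] := sums_to_ex (bessel x).
suff xv : x = v by move: cv; rewrite -xv.
have [_ maxe] := he.
apply/eqP; rewrite -subr_eq0; apply/eqP; apply: maxe => k.
by rewrite linearBl /= (dot_sums_to_basis k cv) subrr.
Qed.

Lemma bconj_sums_to x : sums_to (fun k => (dot x (e k))^*%R) (bconj dot e x).
Proof.
have [|v cv] := @sums_to_ex (fun k => (dot x (e k))^*%R) (rnorm x ^+ 2).
  by move=> J; under eq_bigr do rewrite rnorm_conj; exact: bessel.
by rewrite /bconj (sums_to_sum cv).
Qed.

Lemma rnorm_bconj x : rnorm (bconj dot e x) <= rnorm x.
Proof.
apply: rnorm_sums_to (bconj_sums_to x); first exact: rnorm_ge0.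
by move=> J; under eq_bigr do rewrite rnorm_conj; exact: bessel.
Qed.

Section functional.
Variables (L : {scalar X}) (C : R).
Hypotheses (C0 : 0 <= C) (LC : forall x, rnorm (L x) <= C * rnorm x).

(** Tested on the finite sum with coefficients conjugate to [L (e k)], the functional returns the
    squared norm of that sum. *)
Lemma functional_coef_bound J : \sum_(k <- J) rnorm (L (e k)) ^+ 2 <= C ^+ 2.
Proof.
pose c k := (L (e k))^*%R.
have E : L (fsum c J) = (rnorm (fsum c J) ^+ 2)%:C.
  rewrite rnorm_fsum rmorph_sum /= /fsum linear_sum; apply: eq_bigr => k _.
  by rewrite linearZ_LR /= mulrC -normCK rnormE rnorm_conj rmorphXn.
have := LC (fsum c J); rewrite E rnorm_C ?exprn_ge0 ?rnorm_ge0// => H.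
have -> : \sum_(k <- J) rnorm (L (e k)) ^+ 2 = rnorm (fsum c J) ^+ 2.
  by rewrite rnorm_fsum; apply: eq_bigr => k _; rewrite rnorm_conj.
have [n0|n0] := eqVneq (rnorm (fsum c J)) 0; first by rewrite n0 expr0n /= sqr_ge0.
have n00 : 0 < rnorm (fsum c J) by rewrite lt_def n0 rnorm_ge0.
move: H; rewrite expr2 ler_pM2r// => H.
by rewrite -expr2 ler_pXn2r// nnegrE ?rnorm_ge0.
Qed.

Let G : X := sum (fun k => L (e k) *: e k).

Lemma riesz_sums_to : sums_to (fun k => L (e k)) G.
Proof.
by have [v cv] := sums_to_ex functional_coef_bound; rewrite /G (sums_to_sum cv).
Qed.

Lemma rnorm_riesz : rnorm G <= C.
Proof. exact: rnorm_sums_to C0 functional_coef_bound riesz_sums_to. Qed.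

(** The coefficients of [G] are not conjugated, so [G] depends linearly on [L] and represents it
    through pairing with the conjugate of [x]. This is the convention of the gradient. *)
Lemma riesz_bconj x : dot G (bconj dot e x) = L x.
Proof.
apply: rnorm_small_eq => ep ep0; have ep20 : 0 < ep / 2 by rewrite divr_gt0.
have [J1 H1] := sums_to_dot (bconj dot e x) riesz_sums_to ep20.
have n0 : 0 < C + 1 by rewrite ltr_wpDl.
have [J2 H2] := basis_expansion x (divr_gt0 ep20 n0).
have {}H1 := H1 (J1 `|` J2) (fsubsetUl _ _).
have {}H2 := H2 (J1 `|` J2) (fsubsetUr _ _).
set J := J1 `|` J2 in H1 H2.
have E : dot (fsum (fun k => L (e k)) J) (bconj dot e x) = L (fsum (fun k => dot x (e k)) J).
  rewrite /fsum dot_suml linear_sum; apply: eq_bigr => k _.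
  rewrite dotZl linearZ_LR /= dotC (dot_sums_to_basis k (bconj_sums_to x)).
  by rewrite conjCK mulrC.
rewrite -(subrK (L (fsum (fun k => dot x (e k)) J)) (dot G _)) -addrA.
apply: le_lt_trans (rnormD _ _) _; rewrite -E rnorm_distC E -linearB.
have : rnorm (L (fsum (fun k => dot x (e k)) J - x)) <= ep / 2.
  apply: le_trans (LC _) _; move: H2; rewrite ltr_pdivlMr//.
  have := rnorm_ge0 (fsum (fun k => dot x (e k)) J - x); nra.
move: H1; rewrite E; lra.
Qed.

Lemma le_rnorm_riesz x : rnorm (L x) <= rnorm G * rnorm x.
Proof.
rewrite -riesz_bconj; apply: le_trans (dot_CauchySchwarz _ _) _.
by rewrite ler_wpM2l ?rnorm_ge0// rnorm_bconj.
Qed.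

End functional.

Lemma functional_bound_split (L : {scalar X}) x (c1 c2 : R) : rnorm x = 1 -> 0 <= c1 -> 0 <= c2 ->
  rnorm (L x) <= c1 ->
  (forall v, rnorm v = 1 -> dot x v = 0 -> rnorm (L v) <= c2) ->
  forall y, rnorm (L y) <= Num.sqrt (c1 ^+ 2 + c2 ^+ 2) * rnorm y.
Proof.
move=> x1 c10 c20 Lx Lv y.
pose al := dot y x; pose w := y - al *: x.
have o : dot (al *: x) w = 0.
  rewrite dotZl /w dotC linearBl /= dotZl dot_rnorm x1 expr1n mulr1 subrr conjC0 mulr0 //.
have yE : y = al *: x + w by rewrite /w addrC subrK.
have ny : rnorm y ^+ 2 = rnorm al ^+ 2 + rnorm w ^+ 2.
  by rewrite {1}yE rnorm_pyth// rnormZ x1 mulr1.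
have Lw : rnorm (L w) <= c2 * rnorm w.
  have [w0|w0] := eqVneq w 0; first by rewrite w0 linear0 !rnorm0 mulr0.
  have nw : 0 < rnorm w by rewrite rnorm_gt0.
  pose v := (rnorm w)^-1%:C *: w.
  have v1 : rnorm v = 1 by rewrite rnormZ rnorm_C ?invr_ge0 ?(ltW nw)// mulVf ?gt_eqF.
  have xw : dot x w = 0.
    by rewrite /w dotC linearBl /= dotZl dot_rnorm x1 expr1n mulr1 subrr conjC0.
  have := Lv v v1; rewrite /v dotZr xw mulr0 => /(_ erefl).
  rewrite linearZ_LR rnormM rnorm_C ?invr_ge0 ?(ltW nw)//.
  by rewrite mulrC ler_pdivrMr.
have Ly : rnorm (L y) <= c1 * rnorm al + c2 * rnorm w.
  rewrite {1}yE linearD linearZ_LR; apply: le_trans (rnormD _ _) _.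
  apply: lerD => //; rewrite rnormM mulrC; rewrite ler_wpM2r ?rnorm_ge0//.
apply: le_trans Ly _; apply: ler_of_sqr; first by rewrite mulr_ge0 ?sqrtr_ge0 ?rnorm_ge0.
rewrite exprMn sqr_sqrtr ?addr_ge0 ?sqr_ge0// ny.
(* By Lagrange's identity this square is exactly the gap in the Cauchy-Schwarz inequality in the
   plane. *)
have := sqr_ge0 (c1 * rnorm w - c2 * rnorm al).
set p := rnorm al; set q := rnorm w; lra.
Qed.

End hilbert_space.

(** * The Hahn-Banach theorem *)

Section hahn_banach.
Variables (R : realType) (Y : normedModType R[i]).
Local Open Scope complex_scope.

Definition sublinear (q : Y -> R) : Prop :=
  (forall x y, q (x + y) <= q x + q y) /\
  (forall (t : R) x, 0 <= t -> q (t%:C *: x) = t * q x).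

Lemma sublinear0 q : sublinear q -> q 0 = 0.
Proof. by move=> [_ qZ]; have := qZ 0 0 (lexx _); rewrite scale0r mul0r. Qed.

Lemma sublinear_opp q x : sublinear q -> - q (- x) <= q x.
Proof.
move=> qs; have [qD _] := qs; have := qD x (- x).
by rewrite subrr sublinear0//; lra.
Qed.

(* The function below is sublinear and at most q; if q is minimal it equals q,
   which forces q (x + y) = q x + q y. *)
Definition drop_along (q : Y -> R) y x : R :=
  inf [set q (x + t%:C *: y) - t * q y | t in [set t : R | 0 <= t]].

Section drop_along_theory.
Variables (q : Y -> R) (y : Y).
Hypothesis qs : sublinear q.

Let S x := [set q (x + t%:C *: y) - t * q y | t in [set t : R | 0 <= t]].

Let S_lb x : lbound (S x) (- q (- x)).
Proof.
move=> _ [t t0 <-]; have [qD qZ] := qs.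
have := qD (x + t%:C *: y) (- x); rewrite addrAC subrr add0r qZ//; lra.
Qed.

Lemma drop_along_le_at x t : 0 <= t -> drop_along q y x <= q (x + t%:C *: y) - t * q y.
Proof. by move=> t0; apply: ge_inf; [exists (- q (- x)); exact: S_lb|exists t]. Qed.

Lemma drop_along_ge x B : (forall t, 0 <= t -> B <= q (x + t%:C *: y) - t * q y) ->
  B <= drop_along q y x.
Proof.
move=> H; apply: lb_le_inf; first by exists (q (x + 0%:C *: y) - 0 * q y), 0 => /=.
by move=> _ [t t0 <-]; exact: H.
Qed.

Lemma drop_along_le x : drop_along q y x <= q x.
Proof. by have := drop_along_le_at x (lexx 0); rewrite scale0r addr0 mul0r subr0. Qed.

Lemma drop_along_opp : drop_along q y (- y) <= - q y.
Proof.
by have := drop_along_le_at (- y) ler01; rewrite scale1r addNr sublinear0// mul1r sub0r.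
Qed.

Lemma drop_along_sublinear : sublinear (drop_along q y).
Proof.
have [qD qZ] := qs.
have le s x : 0 < s -> s * drop_along q y x <= drop_along q y (s%:C *: x).
  move=> s0; apply: drop_along_ge => t t0.
  have := drop_along_le_at x (divr_ge0 t0 (ltW s0)); rewrite -(ler_pM2l s0); move/le_trans; apply.
  rewrite mulrBr -(qZ _ _ (ltW s0)) scalerDr scalerA -rmorphM /= (mulrA s (t / s) (q y)).
  by rewrite (_ : s * (t / s) = t)//; field; rewrite gt_eqF.
split=> [x1 x2|s x].
  rewrite -lerBlDr; apply: drop_along_ge => t1 t10.
  rewrite lerBlDr -lerBlDl; apply: drop_along_ge => t2 t20.
  rewrite lerBlDl; apply: le_trans (drop_along_le_at (x1 + x2) (addr_ge0 t10 t20)) _.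
  have := qD (x1 + t1%:C *: y) (x2 + t2%:C *: y).
  by rewrite addrACA -scalerDl -rmorphD /=; lra.
rewrite le_eqVlt => /predU1P[<-|s0].
  rewrite scale0r mul0r; apply/le_anti/andP; split.
    by rewrite (le_trans (drop_along_le _))// sublinear0.
  by apply: drop_along_ge => t t0; rewrite add0r qZ// subrr.
apply/le_anti/andP; split; last exact: le.
have si : 0 < s^-1 by rewrite invr_gt0.
have := le _ (s%:C *: x) si; rewrite scalerA -rmorphM /= mulVf ?gt_eqF// scale1r.
by rewrite mulrC ler_pdivrMr// mulrC.
Qed.

End drop_along_theory.

(** Zorn's lemma: the pointwise infimum of a chain is again sublinear, and it is finite because - q0
    (- x) bounds every member from below. *)
Lemma minimal_sublinear q0 : sublinear q0 ->
  exists l, [/\ sublinear l, forall x, l x <= q0 x &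
    forall q, sublinear q -> (forall x, q x <= l x) -> forall x, l x <= q x].
Proof.
move=> q0s.
pose T := {q : Y -> R | sublinear q /\ forall x, q x <= q0 x}.
pose t0 : T := exist _ q0 (conj q0s (fun x => lexx _)).
(* The order is reversed, so that a maximal element is a minimal functional. *)
pose r (q1 q2 : T) := `[< forall x, sval q2 x <= sval q1 x >].
have [||A Atot|l lmin] := @ZL_preorder T t0 r.
- by move=> t; apply/asboolP.
- move=> q1 q2 q3 /asboolP h12 /asboolP h23; apply/asboolP => x.
  exact: le_trans (h23 x) (h12 x).
- have [[a0 Aa0]|A0] := pselect (A !=set0); last first.
    by exists t0 => s As; exfalso; apply: A0; exists s.
  pose S x := [set sval a x | a in A].
  have Slb x : lbound (S x) (- q0 (- x)).
    move=> _ [a _ <-]; have [as_ aq] := svalP a.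
    by apply: le_trans (sublinear_opp x as_); rewrite lerN2.
  have Sle x a : A a -> inf (S x) <= sval a x.
    by move=> Aa; apply: ge_inf; [exists (- q0 (- x)); exact: Slb|exists a].
  have Sge x B : (forall a, A a -> B <= sval a x) -> B <= inf (S x).
    move=> H; apply: lb_le_inf; first by exists (sval a0 x), a0.
    by move=> _ [a Aa <-]; exact: H.
  pose m x := inf (S x).
  have ms : sublinear m.
    split=> [x y|s x s0].
      rewrite -lerBlDr; apply: (Sge) => a Aa; rewrite lerBlDr -lerBlDl.
      apply: (Sge) => b Ab; rewrite lerBlDl.
      (* The smaller of the two members serves at both [x] and [y]; this is where the chain is
         total. *)
      have [/asboolP ab|/asboolP ba] := Atot a b Aa Ab.
        apply: le_trans (Sle _ _ Ab) _; have [[bD _] _] := svalP b.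
        by apply: le_trans (bD x y) _; rewrite lerD2r.
      apply: le_trans (Sle _ _ Aa) _; have [[aD _] _] := svalP a.
      by apply: le_trans (aD x y) _; rewrite lerD2l.
    apply/le_anti/andP; split; last first.
      apply: (Sge) => a Aa; have [[_ aZ] _] := svalP a.
      by rewrite aZ// ler_wpM2l// Sle.
    have [->|sn0] := eqVneq s 0.
      have [[_ aZ] _] := svalP a0; apply: le_trans (Sle _ _ Aa0) _.
      by rewrite aZ// !mul0r.
    have {}s0 : 0 < s by rewrite lt_def sn0.
    rewrite mulrC -ler_pdivrMr//; apply: (Sge) => a Aa; have [[_ aZ] _] := svalP a.
    by rewrite ler_pdivrMr// mulrC -aZ ?(ltW s0)//; exact: Sle.
  have mq x : m x <= q0 x.
    by have [_ aq] := svalP a0; apply: le_trans (Sle _ _ Aa0) (aq x).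
  exists (exist _ m (conj ms mq)) => a Aa; apply/asboolP => x /=; exact: Sle.
have [ls lq] := svalP l.
exists (sval l); split=> // q qs ql.
have qq0 x : q x <= q0 x by apply: le_trans (ql x) (lq x).
by have := lmin (exist _ q (conj qs qq0)); rewrite /r => /(_ (introT (asboolP _) ql)) /asboolP.
Qed.

(** Minimality is sought below [drop_along p y0] rather than below [p]: this forces l (- y0) <= - p
    y0, hence l y0 = p y0. *)
Lemma real_hahn_banach (p : Y -> R) y0 : sublinear p ->
  exists l : Y -> R, [/\ forall x y, l (x + y) = l x + l y,
    forall (t : R) x, l (t%:C *: x) = t * l x, forall x, l x <= p x & l y0 = p y0].
Proof.
move=> ps; have [l [ls lq lmin]] := minimal_sublinear (drop_along_sublinear y0 ps).
have [lsub lZ] := ls.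
have lp x : l x <= p x by apply: le_trans (lq x) (drop_along_le y0 ps x).
have lD x y : l (x + y) = l x + l y.
  apply/le_anti; rewrite lsub/=.
  (* Minimality against [drop_along l y], used at t = 1, reads l x <= l (x + y) - l y. *)
  have := lmin _ (drop_along_sublinear y ls) (drop_along_le y ls) x.
  have := drop_along_le_at y ls x ler01; rewrite scale1r mul1r; lra.
have lN x : l (- x) = - l x.
  by apply/eqP; rewrite -addr_eq0 -lD addrC subrr sublinear0.
exists l; split => //.
- move=> t x; have [t0|t0] := leP 0 t; first exact: lZ.
  rewrite -[t in LHS]opprK rmorphN scaleNr lN lZ ?oppr_ge0 ?ltW//; lra.
- apply/le_anti; rewrite lp/=.
  have := lq (- y0); rewrite lN => /le_trans /(_ (drop_along_opp y0 ps)); lra.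
Qed.

Lemma scalar_of_linear (V : normedModType R[i]) (f : V -> R[i]) :
  (forall a x y, f (a *: x + y) = a * f x + f y) -> exists u : {scalar V}, u =1 f.
Proof.
move=> fl.
pose u : {scalar V} := HB.pack f (GRing.isLinear.Build _ _ _ _ f fl).
by exists u.
Qed.

(** A change of type: [{scalar V}] scales its values by multiplication, the lemmas on differentials
    by the module action of [R[i]] on itself. *)
Lemma scalar_as_linear (V : normedModType R[i]) (u : {scalar V}) :
  exists u' : {linear V -> R[i]}, u' = u :> (V -> R[i]).
Proof.
have ul : linear (u : V -> R[i]) by move=> a x y; rewrite linearP.
pose u' : {linear V -> R[i]} := HB.pack (u : V -> R[i]) (GRing.isLinear.Build _ _ _ _ _ ul).
by exists u'.
Qed.

Lemma bounded_scalar_continuous (u : {scalar Y}) (C : R) :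
  (forall y, rnorm (u y) <= C * rnorm y) -> continuous (u : Y -> R[i]).
Proof.
move=> uC; have [u' uE] := scalar_as_linear u; rewrite -uE.
apply: bounded_linear_continuous; apply/linear_boundedP.
near=> r => x; rewrite uE !rnormE.
have C' : C%:C <= r by near: r; apply: nbhs_pinfty_ge; exact/complex_realP/ex_intro.
apply: le_trans (_ : C%:C * (rnorm x)%:C <= _); first by rewrite -rmorphM lecR.
by rewrite ler_wpM2r// -[X in X <= _]/(0%:C) lecR rnorm_ge0.
Unshelve. all: by end_near. Qed.

Lemma dual_sphere_le (u : {scalar Y}) y : dual_sphere u -> rnorm (u y) <= rnorm y.
Proof.
move=> [_ u1]; have [->|y0] := eqVneq y 0; first by rewrite linear0 !rnorm0.
have ny : 0 < rnorm y by rewrite rnorm_gt0.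
pose w := (rnorm y)^-1%:C *: y.
have w1 : rnorm w <= 1 by rewrite rnormZ rnorm_C ?invr_ge0 ?(ltW ny)// mulVf ?gt_eqF.
have : ((rnorm (u w : R[i]))%:E <= dual_norm u)%E by apply: ereal_sup_ubound; exists w.
rewrite u1 lee_fin /w linearZ_LR rnormM rnorm_C ?invr_ge0 ?(ltW ny)//.
by rewrite mulrC ler_pdivrMr// mul1r.
Qed.

Lemma exists_norming_functional y0 : y0 != 0 ->
  exists2 u : {scalar Y}, dual_sphere u & rnorm (u y0) = rnorm y0.
Proof.
move=> y00.
have ps : sublinear (@rnorm R Y).
  by split=> [x y|t x t0]; rewrite ?rnormD// rnormZ rnorm_C.
have [l [lD lZ lp ly0]] := real_hahn_banach y0 ps.
(* The complex linear functional with real part [l]; a rotation of the argument transfers the bound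
   from its real part to its modulus. *)
pose f y : R[i] := l y +i* (- l ('i%C *: y)).
have fl a x y : f (a *: x + y) = a * f x + f y.
  case: a => al be.
  have aE : al +i* be = al%:C + be%:C * 'i%C by apply/eqP; rewrite eq_complex /=; apply/andP; split; apply/eqP; ring.
  have E1 : l ((al +i* be) *: x) = al * l x + be * l ('i%C *: x).
    by rewrite aE scalerDl lD lZ -scalerA lZ.
  have E2 : l ('i%C *: ((al +i* be) *: x)) = al * l ('i%C *: x) - be * l x.
    rewrite scalerA (_ : 'i%C * (al +i* be) = al%:C * 'i%C + (- be)%:C).
      by rewrite scalerDl lD -scalerA !lZ mulNr.
    by apply/eqP; rewrite eq_complex /=; apply/andP; split; apply/eqP; ring.
  rewrite /f scalerDr !lD E1 E2.
  by apply/eqP; rewrite eq_complex /=; apply/andP; split; apply/eqP; ring.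
have [u uE] := scalar_of_linear fl.
have Reu y : Re (u y) = l y by rewrite uE.
have up y : rnorm (u y) <= rnorm y.
  have [w w1 wE] := exists_rotation (u y).
  have : Re (u (w *: y)) = rnorm (u y) by rewrite linearZ_LR /= wE.
  by rewrite Reu => <-; apply: le_trans (lp _) _; rewrite rnormZ w1 mul1r.
have uy0 : rnorm (u y0) = rnorm y0.
  apply/le_anti; rewrite up/= -ly0 -Reu.
  by apply: le_trans (Re_le_rnorm _); exact: ler_norm.
exists u => //; split.
  by apply: (@bounded_scalar_continuous u 1) => y; rewrite mul1r.
have n0 : 0 < rnorm y0 by rewrite rnorm_gt0.
apply/le_anti/andP; split.
  by apply: ge_ereal_sup => _ [y /= y1 <-]; rewrite lee_fin (le_trans (up y)).
apply: ereal_sup_ubound; exists ((rnorm y0)^-1%:C *: y0) => /=.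
  by rewrite rnormZ rnorm_C ?invr_ge0 ?(ltW n0)// mulVf ?gt_eqF.
by rewrite linearZ_LR rnormM rnorm_C ?invr_ge0 ?(ltW n0)// uy0 mulVf ?gt_eqF.
Qed.

End hahn_banach.

(** * Gradients and radial derivatives of vector valued functions *)

Section differentials.
Variable R : realType.
Local Open Scope complex_scope.

Lemma differentiable_expansion (V W : normedModType R[i]) (f : V -> W) z :
  differentiable f z -> forall e : R, 0 < e ->
  exists2 r, 0 < r & forall w, rnorm (w - z) < r ->
    rnorm (f w - f z - 'd f z (w - z)) <= e * rnorm (w - z).
Proof.
move=> /diff_locally /eqaddoP df e e0.
have := df e%:C; rewrite -[X in X < _ -> _]/(0%:C) ltcR => /(_ e0).
move=> /nbhs_normP[r /= r0 Hr].
have rE : r = (Re r)%:C by rewrite RRe_real// gtr0_real.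
exists (Re r); first by rewrite -ltcR -rE.
move=> w wr; have := Hr (w - z); rewrite /= sub0r normrN rnormE rE ltcR => /(_ wr).
rewrite !fctE /= subrK opprD addrA !rnormE -rmorphM lecR; exact.
Qed.

Lemma diff_bounded (V W : normedModType R[i]) (f : V -> W) z :
  differentiable f z -> exists2 C : R, 0 <= C & forall h, rnorm ('d f z h) <= C * rnorm h.
Proof.
move=> df; have dc : continuous ('d f z) := diff_continuous df.
have /linear_boundedP := continuous_linear_bounded 0 (dc 0).
move=> /pinfty_ex_gt0[r r0 Hr]; have rE : r = (Re r)%:C by rewrite RRe_real// gtr0_real.
exists (Re r); first by rewrite ltW// -ltcR -rE.
by move=> h; have := Hr h; rewrite rE !rnormE -rmorphM lecR.
Qed.

Lemma cdiff_slice (V : normedModType R[i]) (g : V -> R[i]) p v (zeta : R[i]) :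
  differentiable g (p + zeta *: v) ->
  cdiff (fun l => g (p + l *: v)) zeta ('d g (p + zeta *: v) v).
Proof.
move=> dg e e0.
have n0 : 0 < rnorm v + 1 by rewrite ltr_wpDl ?rnorm_ge0.
have [r r0 Hr] := differentiable_expansion dg (divr_gt0 e0 n0).
exists (r / (rnorm v + 1)); first by rewrite divr_gt0.
move=> w; rewrite ltr_pdivlMr// => wr.
have E : p + w *: v - (p + zeta *: v) = (w - zeta) *: v.
  by rewrite opprD addrACA subrr add0r scalerBl.
have d0 := rnorm_ge0 (w - zeta); have v0 := rnorm_ge0 v.
have := Hr (p + w *: v); rewrite E rnormZ => /(_ _)/le_trans H.
rewrite (_ : 'd g _ v * (w - zeta) = 'd g (p + zeta *: v) ((w - zeta) *: v)); last first.
  by rewrite linearZ mulrC.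
apply: H; first by apply: le_lt_trans wr; rewrite ler_wpM2l// lerDl.
rewrite mulrAC ler_pdivrMr// -mulrA; rewrite ler_wpM2l ?(ltW e0)//.
by rewrite ler_wpM2l// lerDl.
Qed.

Lemma derive1_slice (V W : normedModType R[i]) (f : V -> W) (x : V) (l : R[i]) :
  differentiable f (l *: x) ->
  derive1 (fun w : R[i] => f (w *: x)) l = 'd f (l *: x) x.
Proof.
move=> df.
pose s : {linear R[i] -> V} := HB.pack (fun w : R[i] => w *: x)
  (GRing.isLinear.Build R[i] R[i] V *:%R (fun w : R[i] => w *: x)
    (fun a u v => etrans (scalerDl _ _ _) (congr1 (+%R^~ _) (esym (scalerA _ _ _))))).
have sc : continuous (s : R[i] -> V).
  apply: bounded_linear_continuous; apply/linear_boundedP.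
  near=> r => w.
  have xr : `|x| <= r by near: r; apply: nbhs_pinfty_ge; exact: normr_real.
  by rewrite normrZ mulrC ler_wpM2r.
have ds : differentiable s l by exact: linear_differentiable.
rewrite derive1E deriveE; last exact: (@differentiable_comp _ _ _ _ s f).
rewrite (_ : (fun w : R[i] => f (w *: x)) = f \o s)//.
rewrite diff_comp//; have sE : 'd s l 1 = x by rewrite diff_lin//= scale1r.
exact: (congr1 ('d f (l *: x)) sE).
Unshelve. all: by end_near. Qed.

End differentials.

Section functionals.
Variables (R : realType) (X Y : completeNormedModType R[i]).
Local Open Scope complex_scope.

Lemma differentiable_dual (u : {scalar Y}) (f : X -> Y) z :
  continuous (u : Y -> R[i]) -> differentiable f z ->
  differentiable (u \o f) z /\ 'd (u \o f) z =1 (fun h => u ('d f z h)).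
Proof.
move=> uc df; have [u' uE] := scalar_as_linear u.
have uc' : continuous (u' : Y -> R[i]) by rewrite uE.
have du : differentiable u' (f z) by exact: linear_differentiable.
have cE : u \o f = u' \o f by rewrite uE.
split; first by rewrite cE; exact: differentiable_comp.
move=> h; rewrite cE diff_comp//.
have uE' : 'd u' (f z) =1 u by move=> y; rewrite diff_lin// uE.
exact: uE'.
Qed.

Variable dot : {dot X for @Num.conj R[i]}.
Hypothesis hdot : induces_norm dot.
Variables (Gamma : choiceType) (e : Gamma -> X).
Hypothesis he : orthonormal_basis dot e.

Section at_point.
Variables (g : X -> R[i]) (z : X).
Hypothesis dg : differentiable g z.

Lemma grad_as_functional : exists2 L : {scalar X}, L =1 'd g z &
  grad e g z = sum (fun k => L (e k) *: e k).
Proof.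
have [L LE] : exists L : {scalar X}, L =1 'd g z.
  by apply: scalar_of_linear => a x y; rewrite linearP.
exists L => //; rewrite /grad; congr (sum _); apply/funext => k.
by rewrite deriveE// LE.
Qed.

Lemma rnorm_grad_le (C : R) : 0 <= C -> (forall h, rnorm ('d g z h) <= C * rnorm h) ->
  rnorm (grad e g z) <= C.
Proof.
move=> C0 dC; have [L LE ->] := grad_as_functional.
by apply: (rnorm_riesz hdot he C0) => x; rewrite LE.
Qed.

Lemma diff_le_rnorm_grad h : rnorm ('d g z h) <= rnorm (grad e g z) * rnorm h.
Proof.
have [L LE ->] := grad_as_functional; have [C C0 dC] := diff_bounded dg.
by rewrite -LE; apply: (le_rnorm_riesz hdot he C0) => x; rewrite LE.
Qed.

Lemma radialE : radial dot e g z = 'd g z z.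
Proof.
rewrite /radial; have [L LE ->] := grad_as_functional.
have [C C0 dC] := diff_bounded dg.
by rewrite -LE; apply: (riesz_bconj hdot he C0) => x; rewrite LE.
Qed.

End at_point.

Lemma sup_nneg_ge0 (A : set (\bar R)) : (0 <= sup_nneg A)%E.
Proof. by apply: ereal_sup_ubound; right. Qed.

Lemma sup_nneg_ub (A : set (\bar R)) x : A x -> (x <= sup_nneg A)%E.
Proof. by move=> Ax; apply: ereal_sup_ubound; left. Qed.

Lemma sup_nneg_le (A : set (\bar R)) B : (0 <= B)%E -> (forall x, A x -> (x <= B)%E) ->
  (sup_nneg A <= B)%E.
Proof. by move=> B0 AB; apply: ge_ereal_sup => x [/AB//|->]. Qed.

Variable f : X -> Y.
Hypothesis fhol : holomorphic_ball f.

Lemma grad_norm_le z (C : R) : unit_ball z -> 0 <= C ->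
  (forall u, @dual_sphere R Y u -> forall h, rnorm (u ('d f z h)) <= C * rnorm h) ->
  (grad_norm e f z <= C%:E)%E.
Proof.
move=> zB C0 H; apply: sup_nneg_le; first by rewrite lee_fin.
move=> _ [u uS <-]; rewrite lee_fin.
have [dg gE] := differentiable_dual uS.1 (fhol zB).
by apply: rnorm_grad_le => // h; rewrite gE; exact: H.
Qed.

Lemma radial_le_grad_norm z : unit_ball z ->
  (radial_norm dot e f z <= grad_norm e f z)%E.
Proof.
move=> zB; apply: sup_nneg_le; first exact: sup_nneg_ge0.
move=> _ [u uS <-]; have [dg gE] := differentiable_dual uS.1 (fhol zB).
apply: le_trans (sup_nneg_ub _); last by exists u.
rewrite lee_fin radialE//; apply: le_trans (diff_le_rnorm_grad dg z) _.
by rewrite ler_piMr ?rnorm_ge0// ltW.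
Qed.

(** A norming functional of ['d f z z] recovers the norm in [Y] from scalar radial derivatives. *)
Lemma le_radial_norm z : unit_ball z ->
  ((rnorm ('d f z z))%:E <= radial_norm dot e f z)%E.
Proof.
move=> zB; have [->|y0] := eqVneq ('d f z z) 0.
  by rewrite rnorm0; exact: sup_nneg_ge0.
have [u uS <-] := exists_norming_functional y0.
have [dg gE] := differentiable_dual uS.1 (fhol zB).
by apply: sup_nneg_ub; exists u => //; rewrite radialE// gE.
Qed.

Lemma dual_slices (u : {scalar Y}) p v (zeta : R[i]) : dual_sphere u ->
  rnorm (p + zeta *: v) < 1 ->
  cdiff (fun l => (u \o f) (p + l *: v)) zeta (u ('d f (p + zeta *: v) v)).
Proof.
move=> uS pB; have [dg gE] := differentiable_dual uS.1 (fhol pB).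
by rewrite -gE; exact: cdiff_slice.
Qed.

Lemma dual_diff_linear (u : {scalar Y}) z (a : R[i]) x y :
  u ('d f z (a *: x + y)) = a * u ('d f z x) + u ('d f z y).
Proof. by rewrite linearP linearP. Qed.

(** The slice bound controls the derivative along z / |z| by [c], and [tangential_bound] controls
    the orthogonal directions by 2 c. *)
Lemma grad_norm_le_slices (r eta c : R) z : 0 < eta -> 0 <= c ->
  rnorm z = r -> r + eta <= 1 ->
  (forall x (l : R[i]), rnorm x = 1 -> r - eta < rnorm l < r + eta ->
     rnorm ('d f (l *: x) x) <= c) ->
  (grad_norm e f z <= (Num.sqrt 5 * c)%:E)%E.
Proof.
move=> eta0 c0 zr reta Hc.
have r0 : 0 <= r by rewrite -zr rnorm_ge0.
have r1 : r < 1 by lra.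
have s5 : 1 <= Num.sqrt 5 :> R by rewrite -[X in X <= _]sqrtr1 ler_wsqrtr// ler1n.
have zB : unit_ball z by rewrite /unit_ball /= zr.
apply: grad_norm_le => //; first by rewrite mulr_ge0 ?sqrtr_ge0.
move=> u uS h.
(* At the origin every unit vector is a slice direction, so the slice bound at l = 0 already bounds
   the whole derivative by [c]. *)
have [r00|rn0] := eqVneq r 0.
  have z0 : z = 0 by apply: rnorm0_eq0; rewrite zr.
  apply: le_trans (dual_sphere_le _ uS) _.
  apply: le_trans (_ : c * rnorm h <= _); last first.
    by rewrite ler_wpM2r ?rnorm_ge0// ler_peMl.
  have [->|h0] := eqVneq h 0; first by rewrite linear0 !rnorm0 mulr0.
  have nh : 0 < rnorm h by rewrite rnorm_gt0.
  have := Hc ((rnorm h)^-1%:C *: h) 0.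
  rewrite rnormZ rnorm_C ?invr_ge0 ?(ltW nh)// mulVf ?gt_eqF// => /(_ erefl).
  rewrite rnorm0 r00 sub0r oppr_lt0 add0r eta0 => /(_ isT).
  rewrite scale0r -z0 linearZ rnormZ rnorm_C ?invr_ge0 ?(ltW nh)//.
  by rewrite mulrC ler_pdivrMr.
have rp : 0 < r by rewrite lt_def rn0.
pose x := r^-1%:C *: z.
have x1 : rnorm x = 1 by rewrite rnormZ rnorm_C ?invr_ge0// zr mulVf ?gt_eqF.
have zE : z = r%:C *: x by rewrite scalerA -rmorphM divff// scale1r.
pose D w h := u ('d f w h).
have Dlin w a h1 h2 : D w (a *: h1 + h2) = a * D w h1 + D w h2 by exact: dual_diff_linear.
have gD p v (zeta : R[i]) : rnorm (p + zeta *: v) < 1 ->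
    cdiff (fun l => (u \o f) (p + l *: v)) zeta (D (p + zeta *: v) v).
  exact: dual_slices.
(* The annulus must stay away from 0 for its points to be normalised. *)
pose eta' := Num.min eta (r / 2).
have eta'0 : 0 < eta' by rewrite lt_min eta0 divr_gt0.
have eta'eta : eta' <= eta by rewrite ge_min lexx.
have eta'r : eta' <= r / 2 by rewrite ge_min lexx orbT.
have Dc w : r - eta' < rnorm w < r + eta' -> rnorm (D w w) <= c * rnorm w.
  move=> wr; have nw : 0 < rnorm w by lra.
  apply: le_trans (dual_sphere_le _ uS) _.
  have := Hc ((rnorm w)^-1%:C *: w) (rnorm w)%:C.
  rewrite rnormZ !rnorm_C ?invr_ge0 ?(ltW nw)// mulVf ?gt_eqF// => /(_ erefl).
  move=> /(_ ltac:(lra)).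
  rewrite scalerA -rmorphM divff ?gt_eqF// scale1r linearZ rnormZ rnorm_C ?invr_ge0 ?(ltW nw)//.
  by rewrite mulrC ler_pdivrMr.
have [L LE] : exists L : {scalar X}, L =1 D z.
  by apply: scalar_of_linear => a h1 h2; exact: Dlin.
have Lx : rnorm (L x) <= c.
  rewrite LE; apply: le_trans (dual_sphere_le _ uS) _.
  rewrite zE; apply: Hc => //; rewrite rnorm_C//; lra.
have reta' : r + eta' <= 1 by lra.
have Lv v : rnorm v = 1 -> dot x v = 0 -> rnorm (L v) <= 2 * c.
  move=> v1 xv; rewrite LE zE.
  apply: (tangential_bound Dlin gD rp eta'0 reta' c0 Dc _ r1) => al be.
  have o : dot (al *: x) (be *: v) = 0 by rewrite dotZl dotZr xv !mulr0.
  by rewrite (rnorm_pyth hdot o) (rnormZ al x) (rnormZ be v) x1 v1 !mulr1.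
have c20 : 0 <= 2 * c by rewrite mulr_ge0.
have := functional_bound_split hdot x1 c0 c20 Lx Lv h.
rewrite LE (_ : c ^+ 2 + (2 * c) ^+ 2 = 5 * c ^+ 2); last by ring.
by rewrite sqrtrM// sqrtr_sqr ger0_norm.
Qed.

Lemma diff_slice_le_inside (r eta c : R) x (l : R[i]) : 0 < r -> 0 < eta -> r + eta <= 1 ->
  0 <= c -> (forall w, r - eta < rnorm w < r + eta -> rnorm ('d f w w) <= c * rnorm w) ->
  rnorm x = 1 -> rnorm l <= r -> rnorm ('d f (l *: x) x) <= c.
Proof.
move=> r0 eta0 reta c0 Hc x1 lr.
have [->|y0] := eqVneq ('d f (l *: x) x) 0; first by rewrite rnorm0.
have [u uS <-] := exists_norming_functional y0.
pose D w h := u ('d f w h).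
have Dlin w a h1 h2 : D w (a *: h1 + h2) = a * D w h1 + D w h2 by exact: dual_diff_linear.
have gD p v (zeta : R[i]) : rnorm (p + zeta *: v) < 1 ->
    cdiff (fun l => (u \o f) (p + l *: v)) zeta (D (p + zeta *: v) v).
  exact: dual_slices.
apply: (radial_bound_inside Dlin gD r0 eta0 reta c0 _ x1 lr) => w /Hc.
by apply: le_trans; exact: dual_sphere_le.
Qed.

End functionals.

(** * Comparison of the seminorms *)

Section weight_facts.
Variables (R : realType) (mu : R -> R) (delta a b : R).
Hypothesis hmu : normal_weight mu delta a b.

Lemma weight_gt0 t : 0 <= t < 1 -> 0 < mu t.
Proof. by case: hmu => _ mu0 _ _ _; exact: mu0. Qed.

(** Lower bounds on the weight survive in an annulus; dividing by them turns weighted bounds into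
    the constant [c]. *)
Lemma weight_near r (k : R) : 0 <= r < 1 -> k < mu r ->
  exists2 eta, 0 < eta /\ r + eta <= 1 & forall t, 0 <= t -> r - eta < t < r + eta -> k < mu t.
Proof.
move=> r01 kr; have [mc _ _ _ _] := hmu.
have /subspace_continuousP/(_ r) := mc.
rewrite /= in_itv/= => /(_ r01) /cvgr_gt /(_ k kr).
move=> /nbhs_ballP[d /= d0 Hd].
exists (Num.min d (1 - r)).
  rewrite lt_min d0 subr_gt0; split; first by case/andP: r01.
  have : Num.min d (1 - r) <= 1 - r by rewrite ge_min lexx orbT.
  lra.
have : Num.min d (1 - r) <= 1 - r by rewrite ge_min lexx orbT.
have : Num.min d (1 - r) <= d by rewrite ge_min lexx.
set m := Num.min _ _ => md m1 t t0 tm; apply: Hd.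
  by rewrite /ball/= ltr_norml; lra.
by rewrite /= in_itv/=; lra.
Qed.

Lemma weight_bounded s : s < 1 -> exists2 M, 0 < M & forall t, 0 <= t <= s -> mu t <= M.
Proof.
move=> s1; have [s0|s0] := ltP s 0.
  by exists 1 => // t /andP[t0 ts]; have := le_lt_trans (le_trans t0 ts) s0; rewrite ltxx.
have [mc _ _ _ _] := hmu.
have mc' : {within `[0, s], continuous mu}.
  by apply: continuous_subspaceW mc => t /=; rewrite !in_itv/=; lra.
have [c cs Hc] := EVT_max s0 mc'.
exists (mu c); first by apply: weight_gt0; move: cs; rewrite in_itv/=; lra.
by move=> t ts; apply: Hc; rewrite in_itv.
Qed.

Lemma R_const_ge1 : 1 <= R_const mu delta.
Proof.
have [_ _ [d01 _] _ _] := hmu.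
have mu_pos t : t \in `[0, delta] -> 0 < mu t.
  by rewrite in_itv/= => td; apply: weight_gt0; move: d01; lra.
rewrite /R_const lerDl mulr_ge0//.
  (* On a set without supremum [sup] is 0; otherwise it is at least the positive member [mu 0]. *)
  set S := [set _ | _ in _]; have [hs|/sup_out ->//] := pselect (has_sup S).
  have S0 : S (mu 0) by exists 0 => //=; rewrite in_itv/= lexx; case/andP: d01.
  apply: le_trans (sup_upper_bound hs S0); apply/ltW/mu_pos.
  by rewrite in_itv/= lexx; case/andP: d01.
by apply: Rintegral_ge0 => t /mu_pos t0; rewrite invr_ge0 ltW.
Qed.

End weight_facts.

Lemma norm_to1_cvg0P (R : realType) (V : normedModType R[i]) (h : V -> \bar R) :
  (forall z, rnorm z < 1 -> (0 <= h z)%E) ->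
  (h z @[z --> @norm_to1 R V] --> 0%E) <->
  (forall ep : R, 0 < ep -> exists2 r, r < 1 &
     forall z, r < rnorm z < 1 -> (h z <= ep%:E)%E).
Proof.
move=> h0; split=> [hc ep ep0|H A].
  have : nbhs (0%E : \bar R) [set x | (x <= ep%:E)%E].
    suff : nbhs (0 : R) [set y | y%:E <= ep%:E]%E by [].
    apply/nbhs_ballP; exists ep => //= x.
    by rewrite /ball/= sub0r normrN => xep; rewrite lee_fin ltW// (le_lt_trans (ler_norm x)).
  by move/hc => [r r1 Hr]; exists r => // z /Hr.
move=> /= A0.
have [ep ep0 HA] : exists2 ep : R, 0 < ep & forall y : R, `|y| < ep -> A y%:E.
  have /nbhs_ballP[ep /= ep0 Hep] : nbhs (0 : R) [set y | A y%:E] := A0.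
  by exists ep => // y yep; apply: Hep; rewrite /ball/= sub0r normrN.
have ep20 : 0 < ep / 2 by rewrite divr_gt0.
have [r r1 Hr] := H _ ep20; exists r => // z zr.
have z1 : rnorm z < 1 by case/andP: zr.
have := h0 z z1; have := Hr z zr; rewrite /=; case: (h z) => [y| |]//.
rewrite !lee_fin => y1 y0; apply: HA; rewrite ger0_norm//; lra.
Qed.

Section comparison.
Variables (R : realType) (X Y : completeNormedModType R[i]).
Local Open Scope complex_scope.
Variable dot : {dot X for @Num.conj R[i]}.
Hypothesis hdot : induces_norm dot.
Variables (Gamma : choiceType) (e : Gamma -> X).
Hypothesis he : orthonormal_basis dot e.
Variables (mu : R -> R) (delta a b : R).
Hypothesis hmu : normal_weight mu delta a b.
Variable f : X -> Y.
Hypothesis fhol : holomorphic_ball f.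

Let N z := ((mu (rnorm z))%:E * grad_norm e f z)%E.
Let Rd z := ((mu (rnorm z))%:E * radial_norm dot e f z)%E.

Let mu_gt0 (V : normedModType R[i]) (z : V) : rnorm z < 1 -> 0 < mu (rnorm z).
Proof. by move=> z1; apply: (weight_gt0 hmu); rewrite rnorm_ge0. Qed.

Let mu_ge0E (V : normedModType R[i]) (z : V) : rnorm z < 1 -> (0 <= (mu (rnorm z))%:E)%E.
Proof. by move=> z1; rewrite lee_fin ltW// mu_gt0. Qed.

Let N_ge0 z : rnorm z < 1 -> (0 <= N z)%E.
Proof. by move=> z1; rewrite mule_ge0 ?mu_ge0E ?sup_nneg_ge0. Qed.

Let Rd_ge0 z : rnorm z < 1 -> (0 <= Rd z)%E.
Proof. by move=> z1; rewrite mule_ge0 ?mu_ge0E ?sup_nneg_ge0. Qed.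

Lemma radial_term_le z : rnorm z < 1 -> (Rd z <= N z)%E.
Proof. by move=> z1; apply: lee_wpmul2l; [exact: mu_ge0E|exact: radial_le_grad_norm]. Qed.

Lemma radial_seminorm_le :
  (bloch_seminorm (radial_norm dot e (Y := Y)) mu f <= bloch_seminorm (grad_norm e (Y := Y)) mu f)%E.
Proof.
apply: sup_nneg_le; first exact: sup_nneg_ge0.
move=> _ [z zB <-]; apply: le_trans (radial_term_le zB) _.
by apply: sup_nneg_ub; exists z.
Qed.

Lemma radial_term_bound z (M : R) : rnorm z < 1 -> (Rd z <= M%:E)%E ->
  mu (rnorm z) * rnorm ('d f z z) <= M.
Proof.
move=> z1 H; rewrite -lee_fin EFinM; apply: le_trans H.
by apply: lee_wpmul2l; [exact: mu_ge0E|exact: le_radial_norm].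
Qed.

Lemma slice_termE x (l : R[i]) : rnorm x = 1 -> rnorm l < 1 ->
  slice_term mu f x l = (mu (rnorm l) * rnorm ('d f (l *: x) x))%:E.
Proof.
move=> x1 l1; rewrite /slice_term rnormZ x1 mulr1 derive1_slice//.
by apply: fhol; rewrite /unit_ball /= rnormZ x1 mulr1.
Qed.

(** The radial derivative at [l x] is [l] times the slice derivative, and 1 / |l| is at most 2
    here. *)
Lemma slice_term_outside x (l : R[i]) (M : R) : rnorm x = 1 -> 1 / 2 <= rnorm l < 1 ->
  (Rd (l *: x) <= M%:E)%E -> (slice_term mu f x l <= (2 * M)%:E)%E.
Proof.
move=> x1 /andP[l2 l1] H.
have lx : rnorm (l *: x) = rnorm l by rewrite rnormZ x1 mulr1.
have lx1 : rnorm (l *: x) < 1 by rewrite lx.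
rewrite slice_termE// lee_fin; have := radial_term_bound lx1 H.
rewrite lx linearZ rnormZ.
have := mu_gt0 l1; have := rnorm_ge0 ('d f (l *: x) x).
set p := rnorm ('d f _ _); set m := mu _ => p0 m0 H1.
have : 0 <= m * p by rewrite mulr_ge0// ltW.
move: H1; rewrite mulrCA; nra.
Qed.

Lemma aff_seminorm_finite :
  (bloch_seminorm (radial_norm dot e (Y := Y)) mu f < +oo)%E ->
  (aff_seminorm mu f < +oo)%E.
Proof.
set S := bloch_seminorm _ _ _ => Soo.
have S0 : (0 <= S)%E by exact: sup_nneg_ge0.
pose M := fine S; have ME : S = M%:E by rewrite fineK// ge0_fin_numE.
have M0 : 0 <= M by rewrite -lee_fin -ME.
have RdM z : rnorm z < 1 -> (Rd z <= M%:E)%E.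
  by move=> z1; rewrite -ME; apply: sup_nneg_ub; exists z.
have h01 : 0 <= (1 / 2 : R) < 1 by lra.
have m0 : 0 < mu (1 / 2) := weight_gt0 hmu h01.
have m20 : mu (1 / 2) / 2 < mu (1 / 2) by lra.
have [eta0 [eta00 _] Heta0] := weight_near hmu h01 m20.
pose eta := Num.min eta0 (1 / 4).
have eta_gt0 : 0 < eta by rewrite lt_min eta00; lra.
have etal : eta <= eta0 by rewrite ge_min lexx.
have eta4 : eta <= 1 / 4 by rewrite ge_min lexx orbT.
(* Near the sphere of radius 1/2 the weight exceeds mu (1/2) / 2, and |w| > 1/4. The first fact
   costs a factor 2, dividing by |w| a factor 4. *)
pose c := 8 * M / mu (1 / 2).
have c0 : 0 <= c by rewrite divr_ge0 ?mulr_ge0// ltW.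
have Hc w : 1 / 2 - eta < rnorm w < 1 / 2 + eta -> rnorm ('d f w w) <= c * rnorm w.
  move=> wr; have w1 : rnorm w < 1 by lra.
  have muw : mu (1 / 2) / 2 < mu (rnorm w) by apply: Heta0; rewrite ?rnorm_ge0//; lra.
  have := radial_term_bound w1 (RdM w w1).
  have := rnorm_ge0 ('d f w w); set p := rnorm ('d f w w) => p0 H.
  have H1 : mu (1 / 2) * p <= 2 * M by nra.
  apply: le_trans (_ : 2 * M / mu (1 / 2) <= _); first by rewrite ler_pdivlMr// mulrC.
  rewrite (_ : c * rnorm w = 2 * M / mu (1 / 2) * (4 * rnorm w)); last by rewrite /c; field; rewrite gt_eqF.
  by rewrite ler_peMr ?divr_ge0 ?mulr_ge0 ?(ltW m0)//; lra.
have h1 : 1 / 2 < 1 :> R by lra.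
have [K K0 HK] := weight_bounded hmu h1.
pose B := Num.max (2 * M) (K * c).
have B0 : 0 <= B by rewrite le_max mulr_ge0.
apply: le_lt_trans (ltry B).
apply: sup_nneg_le; first by rewrite lee_fin.
move=> _ [x x1 <-]; apply: sup_nneg_le; first by rewrite lee_fin.
move=> _ [l l1 <-]; rewrite /unit_ball /= in l1; rewrite /unit_sphere /= in x1.
have [l2|l2] := leP (rnorm l) (1 / 2).
  rewrite slice_termE// lee_fin.
  apply: le_trans (_ : K * c <= _); last by rewrite le_max lexx orbT.
  apply: ler_pM; rewrite ?rnorm_ge0 ?(ltW (mu_gt0 l1))//.
    by apply: HK; rewrite rnorm_ge0.
  by apply: (diff_slice_le_inside fhol _ eta_gt0 _ c0 Hc x1 l2); lra.
apply: le_trans (_ : ((2 * M)%:E <= _)%E); last by rewrite lee_fin le_max lexx.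
apply: slice_term_outside => //; first by rewrite (ltW l2).
by apply: RdM; rewrite rnormZ x1 mulr1.
Qed.

(** The hypothesis involves only radii above |z| - eta0, so the same estimate serves the seminorms
    and the limits at the boundary. *)
Lemma grad_term_le z (A : R) (eta0 : R) : rnorm z < 1 -> 0 <= A -> 0 < eta0 ->
  (forall x (l : R[i]), rnorm x = 1 -> rnorm z - eta0 < rnorm l < 1 ->
     (slice_term mu f x l <= A%:E)%E) ->
  (N z <= (Num.sqrt 5 * A)%:E)%E.
Proof.
move=> z1 A0 eta00 HA; set r := rnorm z in z1 HA *.
have r01 : 0 <= r < 1 by rewrite rnorm_ge0.
have m0 := mu_gt0 z1; rewrite -/r in m0.
apply/lee_addgt0Pr => ep ep0.
pose s5 : R := Num.sqrt 5.
have s50 : 0 < s5 by rewrite sqrtr_gt0.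
(* The extra [ep / s5] makes A / c strictly less than mu r, as [weight_near] requires, and costs
   exactly [ep] in the conclusion. *)
pose c := (A + ep / s5) / mu r.
have e1 : 0 < ep / s5 by rewrite divr_gt0.
have c0 : 0 < c by rewrite divr_gt0// ltr_wpDl.
have km : A / c < mu r.
  by rewrite ltr_pdivrMr// /c mulrCA divff ?gt_eqF// mulr1 ltrDl.
have [eta1 [eta10 reta1] Heta1] := weight_near hmu r01 km.
pose eta := Num.min eta0 eta1.
have eta_gt0 : 0 < eta by rewrite lt_min eta00.
have eL0 : eta <= eta0 by rewrite ge_min lexx.
have eL1 : eta <= eta1 by rewrite ge_min lexx orbT.
have reta : r + eta <= 1 by lra.
have H : (grad_norm e f z <= (Num.sqrt 5 * c)%:E)%E.
  apply: (grad_norm_le_slices hdot he fhol eta_gt0 (ltW c0) (erefl r) reta) => x l x1 lr.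
  have l1 : rnorm l < 1 by lra.
  have := HA x l x1; rewrite slice_termE// lee_fin => /(_ ltac:(lra)) H1.
  have ml : A / c < mu (rnorm l) by apply: Heta1; rewrite ?rnorm_ge0//; lra.
  have p0 := rnorm_ge0 ('d f (l *: x) x).
  move: ml; rewrite ltr_pdivrMr// => ml.
  have mg := mu_gt0 l1.
  by rewrite -(ler_pM2l mg); apply: le_trans H1 (ltW ml).
apply: le_trans (lee_wpmul2l (mu_ge0E z1) H) _.
rewrite -EFinM -EFinD lee_fin -/r -/s5 /c.
rewrite le_eqVlt; apply/orP; left; apply/eqP; field.
by rewrite !gt_eqF.
Qed.

Lemma grad_seminorm_le : (aff_seminorm mu f < +oo)%E ->
  (bloch_seminorm (grad_norm e (Y := Y)) mu f <= (Num.sqrt 5)%:E * aff_seminorm mu f)%E.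
Proof.
set S := aff_seminorm _ _ => Soo.
have S0 : (0 <= S)%E by exact: sup_nneg_ge0.
pose A := fine S; have AE : S = A%:E by rewrite fineK// ge0_fin_numE.
have A0 : 0 <= A by rewrite -lee_fin -AE.
rewrite AE -EFinM; apply: sup_nneg_le; first by rewrite lee_fin mulr_ge0 ?sqrtr_ge0.
(* With [eta0 = 1] the lower bound on |l| is negative, hence no restriction. *)
move=> _ [z z1 <-]; apply: (@grad_term_le z A 1) => // x l x1 /andP[_ l1].
rewrite -AE; apply: (@le_trans _ _ (sup_nneg [set slice_term mu f x l | l in @unit_ball R R[i]])).
  by apply: sup_nneg_ub; exists l.
by apply: sup_nneg_ub; exists x.
Qed.

Lemma radial_little : N z @[z --> @norm_to1 R X] --> 0%E -> Rd z @[z --> @norm_to1 R X] --> 0%E.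
Proof.
move=> /(norm_to1_cvg0P N_ge0) H; apply/(norm_to1_cvg0P Rd_ge0) => ep /H[r r1 Hr].
exists r => // z zr; apply: le_trans (Hr z zr); apply: radial_term_le.
by case/andP: zr.
Qed.

Let T (l : R[i]) := sup_nneg [set slice_term mu f x l | x in @unit_sphere R X].
Let T_ge0 (l : R[i]) : rnorm l < 1 -> (0 <= T l)%E.
Proof. by move=> _; exact: sup_nneg_ge0. Qed.

Lemma aff_little : Rd z @[z --> @norm_to1 R X] --> 0%E -> T l @[l --> @norm_to1 R R[i]] --> 0%E.
Proof.
move=> /(norm_to1_cvg0P Rd_ge0) H; apply/(norm_to1_cvg0P T_ge0) => ep ep0.
have ep20 : 0 < ep / 2 by rewrite divr_gt0.
have [r r1 Hr] := H _ ep20; exists (Num.max r (1 / 2)).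
  by rewrite gt_max r1; lra.
move=> l; rewrite gt_max => /andP[/andP[rl l2] l1].
apply: sup_nneg_le; first by rewrite lee_fin ltW.
move=> _ [x x1 <-]; rewrite /unit_sphere /= in x1.
have := @slice_term_outside x l (ep / 2) x1; rewrite (ltW l2) l1 => /(_ isT).
rewrite (_ : 2 * (ep / 2) = ep); last by field.
by apply; apply: Hr; rewrite rnormZ x1 mulr1 rl.
Qed.

Lemma grad_little : T l @[l --> @norm_to1 R R[i]] --> 0%E -> N z @[z --> @norm_to1 R X] --> 0%E.
Proof.
move=> /(norm_to1_cvg0P T_ge0) H; apply/(norm_to1_cvg0P N_ge0) => ep ep0.
have s50 : 0 < Num.sqrt 5 :> R by rewrite sqrtr_gt0.
have ep5 : 0 < ep / Num.sqrt 5 by rewrite divr_gt0.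
have [r r1 Hr] := H _ ep5; exists r => // z /andP[rz z1].
have E : Num.sqrt 5 * (ep / Num.sqrt 5) = ep by field; rewrite gt_eqF.
(* This [eta0] admits exactly the radii above [r], where the slice terms are small. *)
rewrite -{}E; apply: (@grad_term_le z _ (rnorm z - r)) => //; [exact: ltW|by rewrite subr_gt0|].
move=> x l x1 /andP[lr l1]; apply: le_trans (Hr l _); first by apply: sup_nneg_ub; exists x.
by rewrite l1 andbT; move: lr; rewrite opprB addrC subrK.
Qed.

End comparison.

Theorem theorem4p7 (R : realType)
    (X : completeNormedModType R[i]) (dot : {dot X for @Num.conj R[i]})
    (hdot : induces_norm dot)
    (Gamma : choiceType) (e : Gamma -> X) (he : orthonormal_basis dot e)
    (Y : completeNormedModType R[i])
    (mu : R -> R) (delta a b : R) (hmu : normal_weight mu delta a b) :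
  let nabla := grad_norm e (Y := Y) in
  let rad := radial_norm dot e (Y := Y) in
  [/\ bloch_space nabla mu = bloch_space rad mu /\
      bloch_space rad mu = @aff_space R X Y mu,
      little_bloch_space nabla mu = little_bloch_space rad mu /\
      little_bloch_space rad mu = @little_aff_space R X Y mu &
      forall f : X -> Y, bloch_space nabla mu f ->
        (bloch_norm rad mu f <= bloch_norm nabla mu f)%E /\
        (bloch_norm nabla mu f <=
          (2 * Num.sqrt 2 * R_const mu delta)%:E * aff_norm mu f)%E].
Proof.
move=> nabla rad.
(* Three inclusions in a cycle, gradient to radial to affine to gradient, give all equalities. *)
have nr f : bloch_space nabla mu f -> bloch_space rad mu f.
  move=> [fh fN]; split=> //; apply: le_lt_trans fN.
  exact: (radial_seminorm_le hdot he hmu fh).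
have ra f : bloch_space rad mu f -> aff_space mu f.
  by move=> [fh fR]; split=> //; exact: (aff_seminorm_finite hdot he hmu fh fR).
have an f : aff_space mu f -> bloch_space nabla mu f.
  move=> [fh fA]; split=> //.
  apply: le_lt_trans (grad_seminorm_le hdot he hmu fh fA) _.
  by rewrite lte_mul_pinfty// lee_fin sqrtr_ge0.
split.
- split; apply/seteqP; split=> f //; [exact: nr|by move/ra/an|exact: ra|by move/an/nr].
- have nr0 f : little_bloch_space nabla mu f -> little_bloch_space rad mu f.
    by move=> [fN f0]; split; [exact: nr|exact: (radial_little hdot he hmu fN.1 f0)].
  have ra0 f : little_bloch_space rad mu f -> little_aff_space mu f.
    by move=> [fR f0]; split; [exact: ra|exact: (aff_little hdot he hmu fR.1 f0)].
  have an0 f : little_aff_space mu f -> little_bloch_space nabla mu f.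
    by move=> [fA f0]; split; [exact: an|exact: (grad_little hdot he hmu fA.1 f0)].
  by split; apply/seteqP; split=> f; [exact: nr0|by move/ra0/an0|exact: ra0|by move/an0/nr0].
move=> f fN; have fh := fN.1; have [_ fA] := ra _ (nr _ fN); split.
  by rewrite /bloch_norm leeD2l// (radial_seminorm_le hdot he hmu fh).
rewrite /bloch_norm /aff_norm.
have := grad_seminorm_le hdot he hmu fh fA.
set S := bloch_seminorm _ _ _; set A := aff_seminorm _ _ => SA.
have A0 : (0 <= A)%E by exact: sup_nneg_ge0.
pose C := 2 * Num.sqrt 2 * R_const mu delta.
have C5 : Num.sqrt 5 <= C.
  apply: le_trans (_ : 2 * Num.sqrt 2 <= _); last first.
    by rewrite ler_peMr ?mulr_ge0 ?sqrtr_ge0// (R_const_ge1 hmu).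
  apply: ler_of_sqr; first by rewrite mulr_ge0 ?sqrtr_ge0.
  by rewrite exprMn !sqr_sqrtr//; lra.
(* The term |f(0)| occurs in both norms and only asks for a constant of at least 1. *)
have C1 : 1 <= C.
  by apply: le_trans C5; rewrite -[X in X <= _]sqrtr1 ler_wsqrtr// ler1n.
rewrite -/C ge0_muleDr ?lee_fin ?rnorm_ge0//; apply: leeD.
  by rewrite -EFinM lee_fin ler_peMl ?rnorm_ge0.
by apply: le_trans SA _; rewrite lee_wpmul2r// lee_fin.
Qed.
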